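(* Let $T$ be a centralizable endofunctor of a left autonomous category $\mathcal{C}$ and let $(Z_T,\partial)$ be its centralizer. (a) If $T$ is comonoidal, then $Z_T$ is a monad on $\mathcal{C}$, with product $m\colon Z_T^2\to Z_T$ and unit $u\colon 1_{\mathcal{C}}\to Z_T$ defined by $$(\mathrm{id}_{T(Y_1)\otimes T(Y_2)}\otimes m_X)\,\partial^2_{X,Y_1,Y_2}=(T_2(Y_1,Y_2)\otimes \mathrm{id}_{Z_T(X)})\,\partial_{X,Y_1\otimes Y_2},\qquad u_X=(T_0\otimes \mathrm{id}_{Z_T(X)})\,\partial_{X,\mathbf 1}$$ for all objects $X,Y_1,Y_2$ of $\mathcal{C}$. (b) If $(T,\mu,\eta)$ is a monad, then $Z_T$ is comonoidal, with comonoidal structure defined by $$(\mathrm{id}_{T(Y)}\otimes (Z_T)_2(X_1,X_2))\,\partial_{X_1\otimes X_2,Y}=(\mu_Y\otimes \mathrm{id}_{Z_T(X_1)\otimes Z_T(X_2)})(\partial_{X_1,T(Y)}\otimes \mathrm{id}_{Z_T(X_2)})(\mathrm{id}_{X_1}\otimes \partial_{X_2,Y}),$$ $$(\mathrm{id}_{T(Y)}\otimes (Z_T)_0)\,\partial_{\mathbf 1,Y}=\eta_Y$$ for all objects $X_1,X_2,Y$ of $\mathcal{C}$. (c) If $T$ is a bimonad, then $Z_T$ is a bimonad on $\mathcal{C}$, with the monad structure of (a) and the comonoidal structure of (b). (d) If $\mathcal{C}$ is autonomous, $T$ is a bimonad, and $T$ has a right antipode $s^r$, then the bimonad $Z_T$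 has a left antipode $S^l$ defined by $$(\mathrm{id}_{T(Y)}\otimes S^l_X)\,\partial_{{}^\vee Z_T(X),Y}={}^\vee\bigl((s^r_Y\otimes \mathrm{id}_{Z_T(X)})\,\partial_{X,T(Y)^\vee}\bigr)$$ for all objects $X,Y$ of $\mathcal{C}$. (e) If $\mathcal{C}$ is autonomous, $T$ is a bimonad, and $T$ has a left antipode $s^l$, then the bimonad $Z_T$ has a right antipode $S^r$ defined by $$(\mathrm{id}_{T(Y)}\otimes S^r_X)\,\partial_{Z_T(X)^\vee,Y}=\bigl((s^l_Y\otimes \mathrm{id}_{Z_T(X)})\,\partial_{X,{}^\vee T(Y)}\bigr)^\vee$$ for all objects $X,Y$ of $\mathcal{C}$. In particular, if $\mathcal{C}$ is autonomous and $T$ is a Hopf monad, then $Z_T$ is a Hopf monad.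
   Context: Categories are small and monoidal categories are strict, with product $\otimes$ and unit object $\mathbf 1$. A monoidal category is left autonomous (resp. right autonomous) if every object $X$ has a left dual ${}^\vee X$ with $\mathrm{ev}_X\colon {}^\vee X\otimes X\to\mathbf 1$, $\mathrm{coev}_X\colon \mathbf 1\to X\otimes {}^\vee X$ (resp. a right dual $X^\vee$ with $\widetilde{\mathrm{ev}}_X\colon X\otimes X^\vee\to \mathbf 1$, $\widetilde{\mathrm{coev}}_X\colon \mathbf 1\to X^\vee\otimes X$) satisfying the zigzag identities; autonomous means both. Duals are chosen once and for all, ${}^\vee f$ and $f^\vee$ are the left and right dual morphisms, ${}^\vee F(X)$ means ${}^\vee(F(X))$, and the canonical isomorphisms ${}^\vee(X\otimes Y)\cong {}^\vee Y\otimes {}^\vee X$, $(X\otimes Y)^\vee\cong Y^\vee\otimes X^\vee$, ${}^\vee(X^\vee)\cong X\cong ({}^\vee X)^\vee$ are suppressed. A comonoidal functor $F$ is a functor with a natural transformation $F_2(X,Y)\colon F(X\otimes Y)\to F(X)\otimes F(Y)$ and a morphism $F_0\colon F(\mathbf 1)\to \mathbf 1$ satisfying $(\mathrm{id}\otimes F_2(Y,Z))F_2(X,Y\otimes Z)=(F_2(X,Y)\otimes \mathrm{id})F_2(X\otimes Y,Z)$ and $(\mathrm{id}\otimes F_0)F_2(X,\mathbf 1)=\mathrm{id}=(F_0\otimes\mathrm{id})F_2(\mathbf 1,X)$. A natural transformation $\varphi\colon F\to G$ of comonoidal functors is comonoidal if $G_2(X,Y)\varphi_{X\otimes Y}=(\varphi_X\otimes\varphi_Y)F_2(X,Y)$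 and $G_0\varphi_{\mathbf 1}=F_0$. Composites are comonoidal by $(GF)_2(X,Y)=G_2(F(X),F(Y))G(F_2(X,Y))$, $(GF)_0=G_0G(F_0)$. A bimonad on a monoidal category is a monad $(T,\mu,\eta)$ with a comonoidal structure on $T$ such that $\mu\colon T^2\to T$ and $\eta\colon 1\to T$ are comonoidal. A left antipode for $T$ (on a left autonomous category) is a natural transformation $s^l_X\colon T({}^\vee T(X))\to {}^\vee X$ with $T_0T(\mathrm{ev}_X)T({}^\vee\eta_X\otimes \mathrm{id}_X)=\mathrm{ev}_{T(X)}(s^l_{T(X)}T({}^\vee\mu_X)\otimes \mathrm{id})T_2({}^\vee T(X),X)$ and $(\eta_X\otimes \mathrm{id}_{{}^\vee X})\mathrm{coev}_XT_0=(\mu_X\otimes s^l_X)T_2(T(X),{}^\vee T(X))T(\mathrm{coev}_{T(X)})$. A right antipode (on a right autonomous category) is a natural transformation $s^r_X\colon T(T(X)^\vee)\to X^\vee$ with $T_0T(\widetilde{\mathrm{ev}}_X)T(\mathrm{id}_X\otimes\eta_X^\vee)=\widetilde{\mathrm{ev}}_{T(X)}(\mathrm{id}\otimes s^r_{T(X)}T(\mu_X^\vee))T_2(X,T(X)^\vee)$ and $(\mathrm{id}_{X^\vee}\otimes\eta_X)\widetilde{\mathrm{coev}}_XT_0=(s^r_X\otimes\mu_X)T_2(T(X)^\vee,T(X))T(\widetilde{\mathrm{coev}}_{T(X)})$. Antipodes are unique if they exist. A Hopf monad is a bimonad on an autonomous category having a left and a right antipode. Let $T$ be an endofunctor of a monoidal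 category $\mathcal{C}$. A centralizer of $T$ at an object $X$ is a pair $(Z,\delta)$ with $Z$ an object and $\delta=\{\delta_Y\colon X\otimes Y\to T(Y)\otimes Z\}_Y$ natural in $Y$, such that for every object $W$ and natural $\xi=\{\xi_Y\colon X\otimes Y\to T(Y)\otimes W\}_Y$ there is a unique $r\colon Z\to W$ with $\xi_Y=(\mathrm{id}_{T(Y)}\otimes r)\delta_Y$ for all $Y$. A centralizer of $T$ is a pair $(Z_T,\partial)$ with $Z_T$ an endofunctor of $\mathcal{C}$ and $\partial_{X,Y}\colon X\otimes Y\to T(Y)\otimes Z_T(X)$ natural in $X,Y$, such that $(Z_T(X),\partial_{X,-})$ is a centralizer of $T$ at $X$ for each $X$. $T$ is centralizable if it has a centralizer. Set $\partial^2_{X,Y_1,Y_2}=(\mathrm{id}_{T(Y_1)}\otimes\partial_{Z_T(X),Y_2})(\partial_{X,Y_1}\otimes \mathrm{id}_{Y_2})\colon X\otimes Y_1\otimes Y_2\to T(Y_1)\otimes T(Y_2)\otimes Z_T^2(X)$. When $\mathcal{C}$ is left autonomous, every natural family $X\otimes Y_1\otimes Y_2\to T(Y_1)\otimes T(Y_2)\otimes L(X)$ factors as $(\mathrm{id}\otimes r_X)\partial^2_{X,Y_1,Y_2}$ for a unique natural transformation $r\colon Z_T^2\to L$; this, and the universal property of $\partial$, is the sense in which the structural morphisms of $Z_T$ are defined by formulas prescribing the composites $(\mathrm{id}_{T(Y_1)\otimes T(Y_2)}\otimes m_X)\,\partial^2_{X,Y_1,Y_2}$ (for the product $m$), $(\mathrm{id}_{T(Y)}\otimes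 (Z_T)_2(X_1,X_2))\,\partial_{X_1\otimes X_2,Y}$ and $(\mathrm{id}_{T(Y)}\otimes (Z_T)_0)\,\partial_{\mathbf 1,Y}$ (for the comonoidal structure), $(\mathrm{id}_{T(Y)}\otimes S^l_X)\,\partial_{{}^\vee Z_T(X),Y}$ (for the left antipode $S^l$) and $(\mathrm{id}_{T(Y)}\otimes S^r_X)\,\partial_{Z_T(X)^\vee,Y}$ (for the right antipode $S^r$). *)

(* Defs.v *)
Set Implicit Arguments.
Unset Strict Implicit.
Unset Printing Implicit Defensive.

Declare Scope ob_scope.
Declare Scope mor_scope.
Delimit Scope ob_scope with ob.
Delimit Scope mor_scope with mor.

(* Small categories are given by a type of objects and a single type of
   morphisms with domain and codomain maps, so that the strictness axioms are
   plain equations between objects and between morphisms, without transport.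
   Composition [comp g f] (g after f) is a total operation, but the axioms
   constrain it only when dom g = cod f; its other values are irrelevant. *)
Record strict_moncat := StrictMoncat {
  ob : Type;
  mor : Type;
  dom : mor -> ob;
  cod : mor -> ob;
  idm : ob -> mor;
  comp : mor -> mor -> mor;
  unit_ob : ob;
  tens_ob : ob -> ob -> ob;
  tens : mor -> mor -> mor;

  dom_idm : forall X, dom (idm X) = X;
  cod_idm : forall X, cod (idm X) = X;
  dom_comp : forall g f, dom g = cod f -> dom (comp g f) = dom f;
  cod_comp : forall g f, dom g = cod f -> cod (comp g f) = cod g;
  comp_idm_l : forall f, comp (idm (cod f)) f = f;
  comp_idm_r : forall f, comp f (idm (dom f)) = f;
  comp_assoc : forall h g f, dom h = cod g -> dom g = cod f ->
    comp h (comp g f) = comp (comp h g) f;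

  tens_ob_assoc : forall X Y Z,
    tens_ob X (tens_ob Y Z) = tens_ob (tens_ob X Y) Z;
  tens_ob_unit_l : forall X, tens_ob unit_ob X = X;
  tens_ob_unit_r : forall X, tens_ob X unit_ob = X;

  dom_tens : forall f g, dom (tens f g) = tens_ob (dom f) (dom g);
  cod_tens : forall f g, cod (tens f g) = tens_ob (cod f) (cod g);
  tens_idm : forall X Y, tens (idm X) (idm Y) = idm (tens_ob X Y);
  tens_comp : forall g f g' f', dom g = cod f -> dom g' = cod f' ->
    tens (comp g f) (comp g' f') = comp (tens g g') (tens f f');
  tens_assoc : forall f g h, tens f (tens g h) = tens (tens f g) h;
  tens_unit_l : forall f, tens (idm unit_ob) f = f;
  tens_unit_r : forall f, tens f (idm unit_ob) = f
}.

Bind Scope ob_scope with ob.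
Bind Scope mor_scope with mor.
Arguments dom {s} f%_mor : rename.
Arguments cod {s} f%_mor : rename.
Arguments idm {s} X%_ob : rename.
Arguments comp {s} g%_mor f%_mor : rename.
Arguments unit_ob {s}.
Arguments tens_ob {s} X%_ob Y%_ob : rename.
Arguments tens {s} f%_mor g%_mor : rename.

Notation "𝟏" := unit_ob : ob_scope.
Notation "X ⊗ Y" := (tens_ob X Y) (at level 40, left associativity) : ob_scope.
Notation "f ⊗ g" := (tens f g) (at level 40, left associativity) : mor_scope.
Notation "g ∘ f" := (comp g f) (at level 50, left associativity) : mor_scope.

Definition hom (C : strict_moncat) (f : mor C) (X Y : ob C) : Prop :=
  dom f = X /\ cod f = Y.
Arguments hom {C} f%_mor (X Y)%_ob.

(** * Endofunctors and natural transformations *)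

Record endofunctor (C : strict_moncat) := Endofunctor {
  fob :> ob C -> ob C;
  far : mor C -> mor C;
  dom_far : forall f, dom (far f) = fob (dom f);
  cod_far : forall f, cod (far f) = fob (cod f);
  far_idm : forall X, far (idm X) = idm (fob X);
  far_comp : forall g f, dom g = cod f ->
    far (comp g f) = comp (far g) (far f)
}.
Arguments fob {C} e X%_ob : rename.
Arguments far {C} e f%_mor : rename.
Notation "F ⟨ f ⟩" := (far F f)
  (at level 1, f at level 200, left associativity, format "F ⟨ f ⟩")
  : mor_scope.

Definition fid (C : strict_moncat) : endofunctor C.
Proof.
refine (@Endofunctor C (fun X => X) (fun f => f) _ _ _ _); reflexivity.
Defined.
Arguments fid {C}.

Definition fcomp (C : strict_moncat) (G F : endofunctor C) : endofunctor C.
Proof.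
refine (@Endofunctor C (fun X => G (F X)) (fun f => far G (far F f)) _ _ _ _).
- intros f; rewrite !dom_far; reflexivity.
- intros f; rewrite !cod_far; reflexivity.
- intros X; rewrite !far_idm; reflexivity.
- intros g f gf; rewrite (far_comp F gf); apply far_comp.
  rewrite dom_far, cod_far, gf; reflexivity.
Defined.

Local Open Scope mor_scope.

Definition natural (C : strict_moncat) (F G : endofunctor C)
    (phi : ob C -> mor C) : Prop :=
  (forall X, hom (phi X) (F X) (G X)) /\
  (forall f, phi (cod f) ∘ F⟨f⟩ = G⟨f⟩ ∘ phi (dom f)).

(** * Monads, comonoidal functors and bimonads *)

Record is_monad (C : strict_moncat) (T : endofunctor C)
    (mu eta : ob C -> mor C) : Prop := IsMonad {
  mu_natural : natural (fcomp T T) T mu;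
  eta_natural : natural fid T eta;
  mu_assoc : forall X, mu X ∘ T⟨mu X⟩ = mu X ∘ mu (T X);
  mu_eta_l : forall X, mu X ∘ eta (T X) = idm (T X);
  mu_eta_r : forall X, mu X ∘ T⟨eta X⟩ = idm (T X)
}.

Record is_comonoidal (C : strict_moncat) (F : endofunctor C)
    (F2 : ob C -> ob C -> mor C) (F0 : mor C) : Prop := IsComonoidal {
  hom_F2 : forall X Y, hom (F2 X Y) (F (X ⊗ Y)%ob) (F X ⊗ F Y);
  F2_natural : forall f g,
    F2 (cod f) (cod g) ∘ F⟨f ⊗ g⟩ = (F⟨f⟩ ⊗ F⟨g⟩) ∘ F2 (dom f) (dom g);
  hom_F0 : hom F0 (F 𝟏%ob) 𝟏;
  F2_coassoc : forall X Y Z,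
    (idm (F X) ⊗ F2 Y Z) ∘ F2 X (Y ⊗ Z)%ob =
    (F2 X Y ⊗ idm (F Z)) ∘ F2 (X ⊗ Y)%ob Z;
  F2_counit_r : forall X, (idm (F X) ⊗ F0) ∘ F2 X 𝟏%ob = idm (F X);
  F2_counit_l : forall X, (F0 ⊗ idm (F X)) ∘ F2 𝟏%ob X = idm (F X)
}.

Record is_comonoidal_nat (C : strict_moncat)
    (F : endofunctor C) (F2 : ob C -> ob C -> mor C) (F0 : mor C)
    (G : endofunctor C) (G2 : ob C -> ob C -> mor C) (G0 : mor C)
    (phi : ob C -> mor C) : Prop := IsComonoidalNat {
  comonoidal_nat_natural : natural F G phi;
  comonoidal_nat_2 : forall X Y,
    G2 X Y ∘ phi (X ⊗ Y)%ob = (phi X ⊗ phi Y) ∘ F2 X Y;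
  comonoidal_nat_0 : G0 ∘ phi 𝟏%ob = F0
}.

Definition fcomp2 (C : strict_moncat)
    (G : endofunctor C) (G2 : ob C -> ob C -> mor C)
    (F : endofunctor C) (F2 : ob C -> ob C -> mor C) : ob C -> ob C -> mor C :=
  fun X Y => G2 (F X) (F Y) ∘ G⟨F2 X Y⟩.

Definition fcomp0 (C : strict_moncat)
    (G : endofunctor C) (G0 F0 : mor C) : mor C :=
  G0 ∘ G⟨F0⟩.

Definition fid2 (C : strict_moncat) : ob C -> ob C -> mor C :=
  fun X Y => idm (X ⊗ Y).

Definition fid0 (C : strict_moncat) : mor C := idm 𝟏.

Record is_bimonad (C : strict_moncat) (T : endofunctor C)
    (mu eta : ob C -> mor C) (T2 : ob C -> ob C -> mor C) (T0 : mor C)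
    : Prop := IsBimonad {
  bimonad_monad : is_monad T mu eta;
  bimonad_comonoidal : is_comonoidal T T2 T0;
  bimonad_mu : is_comonoidal_nat
    (fcomp T T) (fcomp2 T T2 T T2) (fcomp0 T T0 T0) T T2 T0 mu;
  bimonad_eta : is_comonoidal_nat fid (@fid2 C) (fid0 C) T T2 T0 eta
}.

(** * Duality *)

Record left_duality (C : strict_moncat) := LeftDuality {
  ldual : ob C -> ob C;
  lev : ob C -> mor C;
  lcoev : ob C -> mor C;
  hom_lev : forall X, hom (lev X) (ldual X ⊗ X) 𝟏;
  hom_lcoev : forall X, hom (lcoev X) 𝟏 (X ⊗ ldual X);
  lzigzag1 : forall X, (idm X ⊗ lev X) ∘ (lcoev X ⊗ idm X) = idm X;
  lzigzag2 : forall X,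
    (lev X ⊗ idm (ldual X)) ∘ (idm (ldual X) ⊗ lcoev X) = idm (ldual X)
}.
Arguments ldual {C} l X%_ob : rename.
Arguments lev {C} l X%_ob : rename.
Arguments lcoev {C} l X%_ob : rename.

Record right_duality (C : strict_moncat) := RightDuality {
  rdual : ob C -> ob C;
  rev : ob C -> mor C;
  rcoev : ob C -> mor C;
  hom_rev : forall X, hom (rev X) (X ⊗ rdual X) 𝟏;
  hom_rcoev : forall X, hom (rcoev X) 𝟏 (rdual X ⊗ X);
  rzigzag1 : forall X, (rev X ⊗ idm X) ∘ (idm X ⊗ rcoev X) = idm X;
  rzigzag2 : forall X,
    (idm (rdual X) ⊗ rev X) ∘ (rcoev X ⊗ idm (rdual X)) = idm (rdual X)
}.
Arguments rdual {C} r X%_ob : rename.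
Arguments rev {C} r X%_ob : rename.
Arguments rcoev {C} r X%_ob : rename.

(* For f : X -> Y, a left dual A of Y with evaluation ev : A ⊗ Y -> 𝟏, and a
   left dual B of X with coevaluation coev : 𝟏 -> X ⊗ B, this is the transpose
   A -> B of f. If f is an identity, it is the canonical isomorphism between
   two left duals of the same object. *)
Definition ltranspose (C : strict_moncat) (A B : ob C)
    (ev coev f : mor C) : mor C :=
  (ev ⊗ idm B) ∘ (idm A ⊗ f ⊗ idm B) ∘ (idm A ⊗ coev).

(* The same for right duals, with ev : Y ⊗ A -> 𝟏 and coev : 𝟏 -> B ⊗ X. *)
Definition rtranspose (C : strict_moncat) (A B : ob C)
    (ev coev f : mor C) : mor C :=
  (idm B ⊗ ev) ∘ (idm B ⊗ f ⊗ idm A) ∘ (coev ⊗ idm A).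

Definition ldual_mor (C : strict_moncat) (L : left_duality C) (f : mor C)
    : mor C :=
  ltranspose (ldual L (cod f)) (ldual L (dom f))
    (lev L (cod f)) (lcoev L (dom f)) f.

Definition rdual_mor (C : strict_moncat) (R : right_duality C) (f : mor C)
    : mor C :=
  rtranspose (rdual R (cod f)) (rdual R (dom f))
    (rev R (cod f)) (rcoev R (dom f)) f.

(* ldual Y ⊗ ldual X is a left dual of X ⊗ Y. *)
Definition lev_tens (C : strict_moncat) (L : left_duality C) (X Y : ob C)
    : mor C :=
  lev L Y ∘ (idm (ldual L Y) ⊗ lev L X ⊗ idm Y).

Definition lcoev_tens (C : strict_moncat) (L : left_duality C) (X Y : ob C)
    : mor C :=
  (idm X ⊗ lcoev L Y ⊗ idm (ldual L X)) ∘ lcoev L X.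

(* ldual Y ⊗ ldual X -> ldual (X ⊗ Y) *)
Definition ldual_tens (C : strict_moncat) (L : left_duality C) (X Y : ob C)
    : mor C :=
  ltranspose (ldual L Y ⊗ ldual L X) (ldual L (X ⊗ Y))
    (lev_tens L X Y) (lcoev L (X ⊗ Y)) (idm (X ⊗ Y)).

(* ldual (X ⊗ Y) -> ldual Y ⊗ ldual X *)
Definition ldual_tens_inv (C : strict_moncat) (L : left_duality C)
    (X Y : ob C) : mor C :=
  ltranspose (ldual L (X ⊗ Y)) (ldual L Y ⊗ ldual L X)
    (lev L (X ⊗ Y)) (lcoev_tens L X Y) (idm (X ⊗ Y)).

(* rdual Y ⊗ rdual X is a right dual of X ⊗ Y. *)
Definition rev_tens (C : strict_moncat) (R : right_duality C) (X Y : ob C)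
    : mor C :=
  rev R X ∘ (idm X ⊗ rev R Y ⊗ idm (rdual R X)).

Definition rcoev_tens (C : strict_moncat) (R : right_duality C) (X Y : ob C)
    : mor C :=
  (idm (rdual R Y) ⊗ rcoev R X ⊗ idm Y) ∘ rcoev R Y.

(* rdual Y ⊗ rdual X -> rdual (X ⊗ Y) *)
Definition rdual_tens (C : strict_moncat) (R : right_duality C) (X Y : ob C)
    : mor C :=
  rtranspose (rdual R Y ⊗ rdual R X) (rdual R (X ⊗ Y))
    (rev_tens R X Y) (rcoev R (X ⊗ Y)) (idm (X ⊗ Y)).

(* rdual (X ⊗ Y) -> rdual Y ⊗ rdual X *)
Definition rdual_tens_inv (C : strict_moncat) (R : right_duality C)
    (X Y : ob C) : mor C :=
  rtranspose (rdual R (X ⊗ Y)) (rdual R Y ⊗ rdual R X)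
    (rev R (X ⊗ Y)) (rcoev_tens R X Y) (idm (X ⊗ Y)).

(* X is a left dual of rdual X, via rev X and rcoev X:
   X -> ldual (rdual X) and its inverse. *)
Definition to_ldual_rdual (C : strict_moncat) (L : left_duality C)
    (R : right_duality C) (X : ob C) : mor C :=
  ltranspose X (ldual L (rdual R X))
    (rev R X) (lcoev L (rdual R X)) (idm (rdual R X)).

Definition of_ldual_rdual (C : strict_moncat) (L : left_duality C)
    (R : right_duality C) (X : ob C) : mor C :=
  ltranspose (ldual L (rdual R X)) X
    (lev L (rdual R X)) (rcoev R X) (idm (rdual R X)).

(* X is a right dual of ldual X, via lev X and lcoev X:
   X -> rdual (ldual X) and its inverse. *)
Definition to_rdual_ldual (C : strict_moncat) (L : left_duality C)
    (R : right_duality C) (X : ob C) : mor C :=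
  rtranspose X (rdual R (ldual L X))
    (lev L X) (rcoev R (ldual L X)) (idm (ldual L X)).

Definition of_rdual_ldual (C : strict_moncat) (L : left_duality C)
    (R : right_duality C) (X : ob C) : mor C :=
  rtranspose (rdual R (ldual L X)) X
    (rev R (ldual L X)) (lcoev L X) (idm (ldual L X)).

(** * Antipodes and Hopf monads *)

Record is_left_antipode (C : strict_moncat) (L : left_duality C)
    (T : endofunctor C) (mu eta : ob C -> mor C)
    (T2 : ob C -> ob C -> mor C) (T0 : mor C) (s : ob C -> mor C)
    : Prop := IsLeftAntipode {
  hom_left_antipode : forall X,
    hom (s X) (T (ldual L (T X))) (ldual L X);
  left_antipode_natural : forall f,
    ldual_mor L f ∘ s (cod f) = s (dom f) ∘ T⟨ldual_mor L (T⟨f⟩)⟩;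
  left_antipode_ev : forall X,
    T0 ∘ T⟨lev L X⟩ ∘ T⟨ldual_mor L (eta X) ⊗ idm X⟩ =
    lev L (T X) ∘ ((s (T X) ∘ T⟨ldual_mor L (mu X)⟩) ⊗ idm (T X))
      ∘ T2 (ldual L (T X)) X;
  left_antipode_coev : forall X,
    (eta X ⊗ idm (ldual L X)) ∘ lcoev L X ∘ T0 =
    (mu X ⊗ s X) ∘ T2 (T X) (ldual L (T X)) ∘ T⟨lcoev L (T X)⟩
}.

Record is_right_antipode (C : strict_moncat) (R : right_duality C)
    (T : endofunctor C) (mu eta : ob C -> mor C)
    (T2 : ob C -> ob C -> mor C) (T0 : mor C) (s : ob C -> mor C)
    : Prop := IsRightAntipode {
  hom_right_antipode : forall X,
    hom (s X) (T (rdual R (T X))) (rdual R X);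
  right_antipode_natural : forall f,
    rdual_mor R f ∘ s (cod f) = s (dom f) ∘ T⟨rdual_mor R (T⟨f⟩)⟩;
  right_antipode_ev : forall X,
    T0 ∘ T⟨rev R X⟩ ∘ T⟨idm X ⊗ rdual_mor R (eta X)⟩ =
    rev R (T X) ∘ (idm (T X) ⊗ (s (T X) ∘ T⟨rdual_mor R (mu X)⟩))
      ∘ T2 X (rdual R (T X));
  right_antipode_coev : forall X,
    (idm (rdual R X) ⊗ eta X) ∘ rcoev R X ∘ T0 =
    (s X ⊗ mu X) ∘ T2 (rdual R (T X)) (T X) ∘ T⟨rcoev R (T X)⟩
}.

Record is_hopf_monad (C : strict_moncat) (L : left_duality C)
    (R : right_duality C) (T : endofunctor C) (mu eta : ob C -> mor C)
    (T2 : ob C -> ob C -> mor C) (T0 : mor C) : Prop := IsHopfMonad {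
  hopf_bimonad : is_bimonad T mu eta T2 T0;
  hopf_left_antipode : exists sl, is_left_antipode L T mu eta T2 T0 sl;
  hopf_right_antipode : exists sr, is_right_antipode R T mu eta T2 T0 sr
}.

(** * Centralizers *)

(* Natural families X ⊗ Y -> T Y ⊗ W, indexed by Y. *)
Definition centralizing (C : strict_moncat) (T : endofunctor C) (X W : ob C)
    (xi : ob C -> mor C) : Prop :=
  (forall Y, hom (xi Y) (X ⊗ Y) (T Y ⊗ W)) /\
  (forall g, xi (cod g) ∘ (idm X ⊗ g) = (T⟨g⟩ ⊗ idm W) ∘ xi (dom g)).

Definition is_centralizer_at (C : strict_moncat) (T : endofunctor C)
    (X Z : ob C) (delta : ob C -> mor C) : Prop :=
  centralizing T X Z delta /\
  forall W xi, centralizing T X W xi ->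
    exists! r, hom r Z W /\ forall Y, xi Y = (idm (T Y) ⊗ r) ∘ delta Y.

Record is_centralizer (C : strict_moncat) (T Z : endofunctor C)
    (d : ob C -> ob C -> mor C) : Prop := IsCentralizer {
  hom_centralizer : forall X Y, hom (d X Y) (X ⊗ Y) (T Y ⊗ Z X);
  centralizer_natural : forall f g,
    d (cod f) (cod g) ∘ (f ⊗ g) = (T⟨g⟩ ⊗ Z⟨f⟩) ∘ d (dom f) (dom g);
  centralizer_universal : forall X, is_centralizer_at T X (Z X) (d X)
}.

Section CentralizerStructure.
Variables (C : strict_moncat) (T Z : endofunctor C).
Variable d : ob C -> ob C -> mor C.

Definition centralizer2 (X Y1 Y2 : ob C) : mor C :=
  (idm (T Y1) ⊗ d (Z X) Y2) ∘ (d X Y1 ⊗ idm Y2).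

Definition centralizer_mult (T2 : ob C -> ob C -> mor C)
    (m : ob C -> mor C) : Prop :=
  natural (fcomp Z Z) Z m /\
  forall X Y1 Y2,
    (idm (T Y1 ⊗ T Y2) ⊗ m X) ∘ centralizer2 X Y1 Y2 =
    (T2 Y1 Y2 ⊗ idm (Z X)) ∘ d X (Y1 ⊗ Y2)%ob.

Definition centralizer_unit (T0 : mor C) : ob C -> mor C :=
  fun X => (T0 ⊗ idm (Z X)) ∘ d X 𝟏%ob.

Definition centralizer_comult (mu : ob C -> mor C)
    (Z2 : ob C -> ob C -> mor C) : Prop :=
  (forall X1 X2, hom (Z2 X1 X2) (Z (X1 ⊗ X2)%ob) (Z X1 ⊗ Z X2)) /\
  (forall f g,
    Z2 (cod f) (cod g) ∘ Z⟨f ⊗ g⟩ = (Z⟨f⟩ ⊗ Z⟨g⟩) ∘ Z2 (dom f) (dom g)) /\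
  forall X1 X2 Y,
    (idm (T Y) ⊗ Z2 X1 X2) ∘ d (X1 ⊗ X2)%ob Y =
    (mu Y ⊗ idm (Z X1 ⊗ Z X2)) ∘ (d X1 (T Y) ⊗ idm (Z X2))
      ∘ (idm X1 ⊗ d X2 Y).

Definition centralizer_counit (eta : ob C -> mor C) (Z0 : mor C) : Prop :=
  hom Z0 (Z 𝟏%ob) 𝟏 /\
  forall Y, (idm (T Y) ⊗ Z0) ∘ d 𝟏%ob Y = eta Y.

(* The left dual of a morphism X ⊗ rdual (T Y) -> rdual Y ⊗ Z X is seen as a
   morphism ldual (Z X) ⊗ Y -> T Y ⊗ ldual X. *)
Definition centralizer_left_antipode (L : left_duality C)
    (R : right_duality C) (sr S : ob C -> mor C) : Prop :=
  (forall X, hom (S X) (Z (ldual L (Z X))) (ldual L X)) /\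
  (forall f, ldual_mor L f ∘ S (cod f) = S (dom f) ∘ Z⟨ldual_mor L (Z⟨f⟩)⟩) /\
  forall X Y,
    (idm (T Y) ⊗ S X) ∘ d (ldual L (Z X)) Y =
    (of_ldual_rdual L R (T Y) ⊗ idm (ldual L X))
      ∘ ldual_tens_inv L X (rdual R (T Y))
      ∘ ldual_mor L ((sr Y ⊗ idm (Z X)) ∘ d X (rdual R (T Y)))
      ∘ ldual_tens L (rdual R Y) (Z X)
      ∘ (idm (ldual L (Z X)) ⊗ to_ldual_rdual L R Y).

(* The right dual of a morphism X ⊗ ldual (T Y) -> ldual Y ⊗ Z X is seen as a
   morphism rdual (Z X) ⊗ Y -> T Y ⊗ rdual X. *)
Definition centralizer_right_antipode (L : left_duality C)
    (R : right_duality C) (sl S : ob C -> mor C) : Prop :=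
  (forall X, hom (S X) (Z (rdual R (Z X))) (rdual R X)) /\
  (forall f, rdual_mor R f ∘ S (cod f) = S (dom f) ∘ Z⟨rdual_mor R (Z⟨f⟩)⟩) /\
  forall X Y,
    (idm (T Y) ⊗ S X) ∘ d (rdual R (Z X)) Y =
    (of_rdual_ldual L R (T Y) ⊗ idm (rdual R X))
      ∘ rdual_tens_inv R X (ldual L (T Y))
      ∘ rdual_mor R ((sl Y ⊗ idm (Z X)) ∘ d X (ldual L (T Y)))
      ∘ rdual_tens R (ldual L Y) (Z X)
      ∘ (idm (rdual R (Z X)) ⊗ to_rdual_ldual L R Y).

End CentralizerStructure.

(* Main.v *)
(* By left duality, a map [r : Z X ⊗ V -> W] is determined by the composites
   (id ⊗ r) (∂_{X,Y} ⊗ id_V), and every family natural in Y is of this form.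
   Hence the structure morphisms of Z exist, and an equation between maps out of
   Z may be checked after composing with one or several ∂. There the defining
   formulas replace the structure of Z by that of T: the product of Z becomes
   the coproduct T_2, the coproduct of Z becomes the product of T, and an
   antipode of Z becomes the dual of an antipode of T on the other side. Each
   axiom of Z is thus turned by naturality of ∂ into the dual axiom of T. *)
From Stdlib Require Import List Arith Bool IndefiniteDescription.
Require Import Defs.
Import ListNotations.

Set Implicit Arguments.
Unset Strict Implicit.
Unset Printing Implicit Defensive.

Local Open Scope mor_scope.

(** Composition is total, and associativity and interchange hold only under typing conditions, so
    one string diagram is written by many terms that are not syntactically equal. Two reflective
    tactics absorb this: [diagram] checks equality up to the strict monoidal laws, and [drw]
    rewrites a subdiagram hidden by them, so that a proof lists only its genuine steps. The
    universal property speaks of one object at a time; natural families are assembled from it by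
    choice, and their naturality follows from uniqueness. Duals carry an extra factor on the right
    of [Z X] over to the target, which is what allows a second ∂ to be cancelled. Antipodes change
    sides because the whole prescribed morphism is dualized: inside a left dual, only the right dual
    of [Y] becomes [Y] again. The canonical isomorphisms between duals are explicit here; they are
    eliminated once, in favour of bent morphisms. *)

Section Basics.
Variable C : strict_moncat.
Implicit Types (f g h : mor C) (X Y : ob C).

Lemma hom_comp f g X Y W : hom f X Y -> hom g Y W -> hom (g ∘ f) X W.
Proof.
intros [<- Hf] [Hg <-]; split; [apply dom_comp | apply cod_comp]; congruence.
Qed.

Lemma hom_tens f g X Y X' Y' :
  hom f X Y -> hom g X' Y' -> hom (f ⊗ g) (X ⊗ X') (Y ⊗ Y').
Proof. intros [<- <-] [<- <-]; split; [apply dom_tens | apply cod_tens]. Qed.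

Lemma hom_idm X : hom (idm X) X X.
Proof. split; [apply dom_idm | apply cod_idm]. Qed.

Lemma hom_far (F : endofunctor C) f X Y : hom f X Y -> hom F⟨f⟩ (F X) (F Y).
Proof. intros [<- <-]; split; [apply dom_far | apply cod_far]. Qed.

(** The strictness laws of objects are propositional, so a typing has to be carried along them. *)
Lemma hom_conv f X Y X' Y' : hom f X Y -> X = X' -> Y = Y' -> hom f X' Y'.
Proof. now intros H -> ->. Qed.

Lemma hom_ldual (L : left_duality C) f X Y :
  hom f X Y -> hom (ldual_mor L f) (ldual L Y) (ldual L X).
Proof.
intros [<- <-]; unfold ldual_mor, ltranspose.
pose proof (hom_lcoev L (dom f)) as Hc; pose proof (hom_lev L (cod f)) as He.
eapply hom_comp; [eapply hom_conv|].
- apply hom_tens; [apply hom_idm | exact Hc].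
- apply tens_ob_unit_r.
- apply tens_ob_assoc.
- eapply hom_comp.
  + apply hom_tens; [apply hom_tens; [apply hom_idm | now split] | apply hom_idm].
  + eapply hom_conv; [apply hom_tens; [exact He | apply hom_idm] | easy |].
    apply tens_ob_unit_l.
Qed.

Lemma hom_rdual (R : right_duality C) f X Y :
  hom f X Y -> hom (rdual_mor R f) (rdual R Y) (rdual R X).
Proof.
intros [<- <-]; unfold rdual_mor, rtranspose.
pose proof (hom_rcoev R (dom f)) as Hc; pose proof (hom_rev R (cod f)) as He.
eapply hom_comp; [eapply hom_conv|].
- apply hom_tens; [exact Hc | apply hom_idm].
- apply tens_ob_unit_l.
- easy.
- eapply hom_comp.
  + apply hom_tens; [apply hom_tens; [apply hom_idm | now split] | apply hom_idm].
  + eapply hom_conv;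
      [apply hom_tens; [apply hom_idm | exact He] | apply tens_ob_assoc |].
    apply tens_ob_unit_r.
Qed.

Lemma comp_assoc_hom f g h X Y Z W :
  hom f X Y -> hom g Y Z -> hom h Z W -> h ∘ (g ∘ f) = h ∘ g ∘ f.
Proof. intros [] [] []; apply comp_assoc; congruence. Qed.

Lemma comp_id_l f X Y : hom f X Y -> idm Y ∘ f = f.
Proof. intros [_ <-]; apply comp_idm_l. Qed.

Lemma comp_id_r f X Y : hom f X Y -> f ∘ idm X = f.
Proof. intros [<- _]; apply comp_idm_r. Qed.

Lemma interchange f g f' g' X Y Z X' Y' Z' :
  hom f X Y -> hom g Y Z -> hom f' X' Y' -> hom g' Y' Z' ->
  (g ∘ f) ⊗ (g' ∘ f') = (g ⊗ g') ∘ (f ⊗ f').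
Proof. intros [] [] [] []; apply tens_comp; congruence. Qed.

End Basics.

Create HintDb hom.
#[global] Hint Resolve hom_idm hom_far hom_ldual hom_rdual hom_tens hom_lev hom_lcoev
  hom_rev hom_rcoev : hom.

(** * Deciding equations that hold in every strict monoidal category *)

(** Atoms and generators are indices into lists of objects and morphisms, so that expressions are
    compared by computation. *)
Inductive oexpr := OUnit | OAtom (i : nat) | OTens (a b : oexpr).

Inductive mexpr :=
  | MId (a : oexpr) | MGen (k : nat) | MComp (g f : mexpr) | MTens (f g : mexpr).

Definition word := list nat.

(* [(l, k, r)] is the generator [k] tensored with the identities of [l] and
   [r]; a list of layers is composed from its head to its tail. *)
Definition layer : Type := word * nat * word.

Fixpoint oword (a : oexpr) : word :=
  match a with
  | OUnit => []
  | OAtom i => [i]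
  | OTens a b => oword a ++ oword b
  end.

Definition word_eqb (v w : word) : bool :=
  if list_eq_dec Nat.eq_dec v w then true else false.

Definition layer_eqb (x y : layer) : bool :=
  let '(l, k, r) := x in let '(l', k', r') := y in
  word_eqb l l' && (k =? k') && word_eqb r r'.

Lemma word_eqb_eq v w : word_eqb v w = true -> v = w.
Proof. unfold word_eqb; destruct (list_eq_dec _ _ _); easy. Qed.

Lemma layer_eqb_eq x y : layer_eqb x y = true -> x = y.
Proof.
destruct x as [[l k] r], y as [[l' k'] r']; cbn; rewrite !andb_true_iff.
intros [[->%word_eqb_eq ->%Nat.eqb_eq] ->%word_eqb_eq]; reflexivity.
Qed.

Section Layers.
Variable sg : list (oexpr * oexpr).

Definition gdom k := oword (fst (nth k sg (OUnit, OUnit))).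
Definition gcod k := oword (snd (nth k sg (OUnit, OUnit))).

Definition gen_of (x : layer) : nat := snd (fst x).

Definition ldom (x : layer) := let '(l, k, r) := x in l ++ gdom k ++ r.
Definition lcod (x : layer) := let '(l, k, r) := x in l ++ gcod k ++ r.

Definition whisk (a b : word) (x : layer) : layer :=
  let '(l, k, r) := x in (a ++ l, k, r ++ b).

(** Ill-typed expressions get [None]: the monoidal laws hold only for composable morphisms. *)
Fixpoint mtype (e : mexpr) : option (word * word) :=
  match e with
  | MId a => Some (oword a, oword a)
  | MGen k => Some (gdom k, gcod k)
  | MComp g f =>
    match mtype g, mtype f with
    | Some (b, c), Some (a, b') =>
      if word_eqb b b' then Some (a, c) else None
    | _, _ => None
    end
  | MTens f g =>
    match mtype f, mtype g with
    | Some (a, b), Some (a', b') => Some (a ++ a', b ++ b')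
    | _, _ => None
    end
  end.

(** A tensor product is cut as [(f ⊗ id) ∘ (id ⊗ g)]: the layers of [g] come first, beside the
    domain of [f], and those of [f] follow, beside the codomain of [g]. *)
Fixpoint layers (e : mexpr) : list layer :=
  match e with
  | MId _ => []
  | MGen k => [([], k, [])]
  | MComp g f => layers f ++ layers g
  | MTens f g =>
    match mtype f, mtype g with
    | Some (a, _), Some (_, b') =>
      map (whisk a []) (layers g) ++ map (whisk [] b') (layers f)
    | _, _ => []
    end
  end.

(* The ways of writing [y] after [x] as a layer [x'] after a layer [y'], as
   pairs [(y', x')]; there are two of them when [x] ends in [𝟏] and [y]
   starts from [𝟏] at the same place. *)
Definition swaps (x y : layer) : list (layer * layer) :=
  let '(l, h, r) := x in let '(l', g, r') := y in
  let m := skipn (length l + length (gcod h)) l' in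
  let n := skipn (length l' + length (gdom g)) l in
  (if word_eqb l' (l ++ gcod h ++ m) && word_eqb r (m ++ gdom g ++ r')
   then [((l ++ gdom h ++ m, g, r'), (l, h, m ++ gcod g ++ r'))] else []) ++
  (if word_eqb l (l' ++ gdom g ++ n) && word_eqb r' (n ++ gcod h ++ r)
   then [((l', g, n ++ gdom h ++ r), (l' ++ gcod g ++ n, h, r))] else []).

Fixpoint pull_over (xs : list layer) (y : layer) : list (layer * list layer) :=
  match xs with
  | [] => [(y, [])]
  | x :: xs =>
    flat_map (fun p => map (fun q => (fst q, snd q :: snd p)) (swaps x (fst p)))
      (pull_over xs y)
  end.

(* The ways of moving an occurrence of the generator [k] to the front. *)
Fixpoint pull (k : nat) (xs : list layer) : list (layer * list layer) :=
  match xs with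
  | [] => []
  | x :: xs =>
    (if gen_of x =? k then [(x, xs)] else []) ++
    flat_map (fun p => map (fun q => (fst q, snd q :: snd p)) (swaps x (fst p)))
      (pull k xs)
  end.

(* Nested [if]s, because the arguments of [&&] and [||] would all be evaluated
   by the virtual machine. *)
Fixpoint exists_lazy {A} (f : A -> bool) (s : list A) : bool :=
  match s with
  | [] => false
  | x :: s => if f x then true else exists_lazy f s
  end.

(** Backtracking is needed because a generator may occur several times and [swaps] may offer two
    results. Success exhibits [ys] as a rearrangement of [xs] by interchange. *)
Fixpoint equiv (xs ys : list layer) : bool :=
  match xs with
  | [] => match ys with [] => true | _ => false end
  | x :: xs =>
    exists_lazy (fun p => if layer_eqb x (fst p) then equiv xs (snd p) else false)
      (pull (gen_of x) ys)
  end.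

Definition equiv_expr (e e' : mexpr) : bool :=
  match mtype e, mtype e' with
  | Some (a, b), Some (a', b') =>
    word_eqb a a' && word_eqb b b' && equiv (layers e) (layers e')
  | _, _ => false
  end.

Fixpoint chain (a : word) (xs : list layer) (b : word) : Prop :=
  match xs with
  | [] => a = b
  | x :: xs => a = ldom x /\ chain (lcod x) xs b
  end.

Lemma chain_app a b c xs ys :
  chain a xs b -> chain b ys c -> chain a (xs ++ ys) c.
Proof.
revert a; induction xs as [|x xs IH]; cbn; intros a.
- now intros ->.
- intros [-> H] H'; split; auto.
Qed.

Lemma chain_whisk a b u v xs :
  chain a xs b -> chain (u ++ a ++ v) (map (whisk u v) xs) (u ++ b ++ v).
Proof.
revert a; induction xs as [|[[l k] r] xs IH]; cbn; intros a.
- now intros ->.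
- intros [-> H]; split; [now rewrite !app_assoc|].
  apply IH in H; rewrite <- !app_assoc in H; rewrite <- !app_assoc; exact H.
Qed.

Lemma layers_chain e a b : mtype e = Some (a, b) -> chain a (layers e) b.
Proof.
revert a b; induction e as [o|k|g IHg f IHf|f IHf g IHg]; cbn; intros a b.
- now intros [= <- <-].
- intros [= <- <-]; rewrite !app_nil_r; auto.
- destruct (mtype g) as [[b' c]|], (mtype f) as [[a' b'']|]; try easy.
  destruct (word_eqb b' b'') eqn:E; [|easy]; apply word_eqb_eq in E as ->.
  intros [= <- <-]; eauto using chain_app.
- destruct (mtype f) as [[a1 b1]|], (mtype g) as [[a2 b2]|]; try easy.
  intros [= <- <-]; apply chain_app with (a1 ++ b2).
  + specialize (IHg _ _ eq_refl); apply (chain_whisk a1 []) in IHg.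
    now rewrite !app_nil_r in IHg.
  + specialize (IHf _ _ eq_refl); now apply (chain_whisk [] b2) in IHf.
Qed.

(** * Soundness of the comparison of layers in a strict monoidal category *)

Section Denotation.
Variables (C : strict_moncat) (eo : list (ob C)) (em : list (mor C)).

Fixpoint oden (a : oexpr) : ob C :=
  match a with
  | OUnit => 𝟏
  | OAtom i => nth i eo 𝟏%ob
  | OTens a b => oden a ⊗ oden b
  end.

Fixpoint mden (e : mexpr) : mor C :=
  match e with
  | MId a => idm (oden a)
  | MGen k => nth k em (idm 𝟏)
  | MComp g f => mden g ∘ mden f
  | MTens f g => mden f ⊗ mden g
  end.

Fixpoint wden (w : word) : ob C :=
  match w with
  | [] => 𝟏
  | i :: w => nth i eo 𝟏%ob ⊗ wden w
  end.

Definition lden (x : layer) : mor C :=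
  let '(l, k, r) := x in idm (wden l) ⊗ nth k em (idm 𝟏) ⊗ idm (wden r).

(** The word [a] gives the object of the identity that the empty list denotes. *)
Fixpoint lsden (a : word) (xs : list layer) : mor C :=
  match xs with
  | [] => idm (wden a)
  | x :: xs => lsden (lcod x) xs ∘ lden x
  end.

Hypothesis typed :
  Forall2 (fun f s => hom f (oden (fst s)) (oden (snd s))) em sg.

Lemma wden_app v w : wden (v ++ w) = (wden v ⊗ wden w)%ob.
Proof.
induction v as [|i v IH]; cbn; [now rewrite tens_ob_unit_l|].
now rewrite IH, tens_ob_assoc.
Qed.

Lemma oden_word a : oden a = wden (oword a).
Proof.
induction a as [|i|a IHa b IHb]; cbn; [easy | now rewrite tens_ob_unit_r |].
now rewrite wden_app, IHa, IHb.
Qed.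

Lemma hom_gen k : hom (nth k em (idm 𝟏)) (wden (gdom k)) (wden (gcod k)).
Proof.
unfold gdom, gcod; rewrite <- !oden_word; clear - typed; intros; revert k.
(* Past the end of the lists the default morphism [idm 𝟏] has the default type [(OUnit, OUnit)], so
   every [k] is covered. *)
induction typed as [|f s em' sg' Hf H IH]; intros [|k]; cbn; auto using hom_idm.
Qed.

Lemma hom_layer x : hom (lden x) (wden (ldom x)) (wden (lcod x)).
Proof.
destruct x as [[l k] r]; cbn; rewrite !wden_app, !tens_ob_assoc.
auto using hom_tens, hom_idm, hom_gen.
Qed.

Lemma hom_layers a b xs : chain a xs b -> hom (lsden a xs) (wden a) (wden b).
Proof.
revert a; induction xs as [|x xs IH]; cbn; intros a.
- intros ->; apply hom_idm.
- intros [-> H]; eapply hom_comp; [apply hom_layer | auto].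
Qed.

Lemma lsden_app a b c xs ys : chain a xs b -> chain b ys c ->
  lsden a (xs ++ ys) = lsden b ys ∘ lsden a xs.
Proof.
revert a; induction xs as [|x xs IH]; cbn; intros a.
- intros -> H; symmetry; eapply comp_id_r, hom_layers, H.
- intros [-> H] H'; rewrite (IH _ H H'); symmetry.
  eapply comp_assoc_hom; [apply hom_layer | apply hom_layers, H |].
  apply hom_layers, H'.
Qed.

Lemma lden_whisk u v x :
  lden (whisk u v x) = idm (wden u) ⊗ lden x ⊗ idm (wden v).
Proof.
destruct x as [[l k] r]; cbn; rewrite !wden_app, <- !tens_idm.
now rewrite !tens_assoc.
Qed.

Lemma lsden_whisk u v a b xs : chain a xs b ->
  lsden (u ++ a ++ v) (map (whisk u v) xs) =
  idm (wden u) ⊗ lsden a xs ⊗ idm (wden v).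
Proof.
revert a; induction xs as [|x xs IH]; cbn; intros a.
- intros _; now rewrite !wden_app, <- !tens_idm, tens_assoc.
- intros [-> H].
  replace (lcod (whisk u v x)) with (u ++ lcod x ++ v)
    by (destruct x as [[l k] r]; cbn; now rewrite <- !app_assoc).
  rewrite (IH _ H), lden_whisk.
  pose proof (hom_layer x) as Hx; pose proof (hom_layers H) as Hxs.
  rewrite <- (comp_id_l (hom_idm (wden u))) at 3.
  rewrite <- (comp_id_l (hom_idm (wden v))) at 3.
  rewrite (interchange (hom_idm (wden u)) (hom_idm (wden u)) Hx Hxs).
  symmetry; eapply interchange.
  + apply hom_tens; [apply hom_idm | exact Hx].
  + apply hom_tens; [apply hom_idm | exact Hxs].
  + apply hom_idm.
  + apply hom_idm.
Qed.

Lemma layers_den e a b : mtype e = Some (a, b) ->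
  mden e = lsden a (layers e).
Proof.
revert a b; induction e as [o|k|g IHg f IHf|f IHf g IHg]; cbn; intros a b.
- intros [= <- <-]; now rewrite oden_word.
- intros [= <- <-]; rewrite tens_unit_l, tens_unit_r, app_nil_r.
  symmetry; eapply comp_id_l, hom_gen.
- destruct (mtype g) as [[b' c]|] eqn:Eg, (mtype f) as [[a' b'']|] eqn:Ef; try easy.
  destruct (word_eqb b' b'') eqn:E; [|easy]; apply word_eqb_eq in E as ->.
  intros [= <- <-]; rewrite (IHg _ _ eq_refl), (IHf _ _ eq_refl).
  apply layers_chain in Eg, Ef; symmetry; eapply lsden_app; eassumption.
- destruct (mtype f) as [[a1 b1]|] eqn:Ef, (mtype g) as [[a2 b2]|] eqn:Eg; try easy.
  intros [= <- <-]; rewrite (IHf _ _ eq_refl), (IHg _ _ eq_refl).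
  apply layers_chain in Eg, Ef.
  pose proof (chain_whisk a1 [] Eg) as Eg'; rewrite !app_nil_r in Eg'.
  pose proof (chain_whisk [] b2 Ef) as Ef'; cbn in Ef'.
  rewrite (lsden_app Eg' Ef').
  pose proof (lsden_whisk a1 [] Eg) as Dg; rewrite app_nil_r in Dg.
  pose proof (lsden_whisk [] b2 Ef) as Df; cbn in Df.
  rewrite Dg, Df; cbn [wden]; rewrite tens_unit_l, tens_unit_r.
  apply hom_layers in Eg, Ef.
  rewrite <- (interchange (hom_idm (wden a1)) Ef Eg (hom_idm _)).
  now rewrite (comp_id_r Ef), (comp_id_l Eg).
Qed.

Lemma exchange_layers l g m h r X1 X2 Y1 Y2 :
  hom g X1 X2 -> hom h Y1 Y2 ->
  (idm (wden l ⊗ X2 ⊗ wden m) ⊗ h ⊗ idm (wden r))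
    ∘ (idm (wden l) ⊗ g ⊗ idm (wden m ⊗ Y1 ⊗ wden r)) =
  (idm (wden l) ⊗ g ⊗ idm (wden m ⊗ Y2 ⊗ wden r))
    ∘ (idm (wden l ⊗ X1 ⊗ wden m) ⊗ h ⊗ idm (wden r)).
Proof.
intros Hg Hh.
(* Both composites collapse to the tensor product of [p] and [q] with the same three identities. *)
assert (E : forall p q, hom p X1 X2 -> hom q Y1 Y2 ->
  (idm (wden l ⊗ X2 ⊗ wden m) ⊗ q ⊗ idm (wden r))
    ∘ (idm (wden l) ⊗ p ⊗ idm (wden m ⊗ Y1 ⊗ wden r)) =
  idm (wden l) ⊗ p ⊗ idm (wden m) ⊗ q ⊗ idm (wden r) /\
  (idm (wden l) ⊗ p ⊗ idm (wden m ⊗ Y2 ⊗ wden r))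
    ∘ (idm (wden l ⊗ X1 ⊗ wden m) ⊗ q ⊗ idm (wden r)) =
  idm (wden l) ⊗ p ⊗ idm (wden m) ⊗ q ⊗ idm (wden r)).
{ intros p q Hp Hq; rewrite <- !tens_idm, !tens_assoc; split.
  all: repeat (erewrite <- interchange; [|eauto 6 using hom_tens, hom_idm ..]).
  all: rewrite ?(comp_id_l Hp), ?(comp_id_l Hq),
    ?(comp_id_r Hp), ?(comp_id_r Hq),
    !(comp_id_l (hom_idm _)); reflexivity. }
destruct (E _ _ Hg Hh) as [-> ->]; reflexivity.
Qed.

Lemma swaps_den x y y' x' : In (y', x') (swaps x y) ->
  ldom y' = ldom x /\ (lcod x = ldom y -> lcod y' = ldom x') /\
  lcod x' = lcod y /\ lden y ∘ lden x = lden x' ∘ lden y'.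
Proof.
destruct x as [[l h] r], y as [[l' g] r']; unfold swaps.
(* The guessed words can be forgotten: the tests in [swaps] establish the equations on which the
   exchange rests. *)
set (m := skipn _ l'); set (n := skipn _ l); clearbody m n.
rewrite in_app_iff; intros [H|H].
- destruct (word_eqb _ _) eqn:E1 in H; [|easy].
  destruct (word_eqb _ _) eqn:E2 in H; [|easy].
  apply word_eqb_eq in E1, E2; subst l' r.
  destruct H as [[= <- <-]|[]]; cbn; rewrite <- !app_assoc; repeat split.
  rewrite !wden_app, !tens_ob_assoc.
  exact (exchange_layers l m r' (hom_gen h) (hom_gen g)).
- destruct (word_eqb _ _) eqn:E1 in H; [|easy].
  destruct (word_eqb _ _) eqn:E2 in H; [|easy].
  apply word_eqb_eq in E1, E2; subst l r'.
  destruct H as [[= <- <-]|[]]; cbn; rewrite <- !app_assoc; repeat split.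
  rewrite !wden_app, !tens_ob_assoc.
  exact (eq_sym (exchange_layers l' n r (hom_gen g) (hom_gen h))).
Qed.

Lemma pull_den k xs y ys a b : In (y, ys) (pull k xs) -> chain a xs b ->
  chain a (y :: ys) b /\ lsden a xs = lsden a (y :: ys).
Proof.
revert y ys a; induction xs as [|x xs IH]; [easy|].
intros y ys a; cbn [pull]; rewrite in_app_iff; intros [H|H] Hc.
{ destruct (gen_of x =? k); [now destruct H as [[= <- <-]|[]] | easy]. }
apply in_flat_map in H as [[z zs] [Hz H]].
apply in_map_iff in H as [[y' x'] [[= <- <-] H]].
destruct Hc as [-> Hc]; destruct (IH _ _ _ Hz Hc) as [[Ez Hzs] Dz].
destruct (swaps_den H) as (E1 & E2 & E3 & E4); cbn in *.
rewrite E3, Dz.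
assert (E5 := E2 Ez); repeat split; auto.
pose proof (hom_layers Hzs) as H1.
assert (H2 := hom_layer z); rewrite <- Ez in H2.
assert (H3 := hom_layer x'); rewrite E3, <- E5 in H3.
rewrite <- (comp_assoc_hom (hom_layer x) H2 H1), E4.
symmetry; rewrite (comp_assoc_hom (hom_layer y') H3 H1).
reflexivity.
Qed.

Lemma exists_lazy_exists {A} (f : A -> bool) s :
  exists_lazy f s = true -> exists x, In x s /\ f x = true.
Proof.
induction s as [|x s IH]; cbn; [easy|].
destruct (f x) eqn:E; [eauto | intros (y & Hy & E')%IH; eauto].
Qed.

Lemma equiv_den xs ys a b : chain a xs b -> chain a ys b -> equiv xs ys = true ->
  lsden a xs = lsden a ys.
Proof.
revert ys a; induction xs as [|x xs IH]; intros ys a Hx Hy.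
- now destruct ys.
- cbn [equiv]; intros [[y zs] [Hin H]]%exists_lazy_exists; cbn in H.
  destruct (layer_eqb x y) eqn:E; [apply layer_eqb_eq in E as -> | easy].
  destruct (pull_den Hin Hy) as [[_ Hz] ->]; cbn.
  destruct Hx as [_ Hx]; f_equal; eauto.
Qed.

Lemma equiv_expr_den e e' : equiv_expr e e' = true -> mden e = mden e'.
Proof.
unfold equiv_expr.
destruct (mtype e) as [[a b]|] eqn:E, (mtype e') as [[a' b']|] eqn:E'; try easy.
rewrite !andb_true_iff; intros [[<-%word_eqb_eq <-%word_eqb_eq] H].
rewrite (layers_den E), (layers_den E').
eapply equiv_den; eauto using layers_chain.
Qed.

Definition type_expr (e : mexpr) (a b : oexpr) : bool :=
  match mtype e with
  | Some (v, w) => word_eqb v (oword a) && word_eqb w (oword b)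
  | None => false
  end.

Lemma type_expr_den e a b : type_expr e a b = true ->
  hom (mden e) (oden a) (oden b).
Proof.
unfold type_expr; destruct (mtype e) as [[v w]|] eqn:E; [|easy].
rewrite andb_true_iff; intros [->%word_eqb_eq ->%word_eqb_eq].
rewrite (layers_den E), !oden_word; apply hom_layers, layers_chain, E.
Qed.

End Denotation.

(** * Rewriting a subdiagram *)

Fixpoint first_some {A B} (f : A -> option B) (s : list A) : option B :=
  match s with
  | [] => None
  | x :: s => match f x with Some y => Some y | None => first_some f s end
  end.

(** The whiskering that turns the pattern layer [p] into [x]: guessed from lengths, then tested. *)
Definition frame (p x : layer) : option (word * word) :=
  let '(l, k, r) := p in let '(l', k', r') := x in
  let a := firstn (length l' - length l) l' in
  let b := skipn (length r) r' in
  if layer_eqb x (a ++ l, k, r ++ b) then Some (a, b) else None.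

Fixpoint layers_eqb (xs ys : list layer) : bool :=
  match xs, ys with
  | [], [] => true
  | x :: xs, y :: ys => layer_eqb x y && layers_eqb xs ys
  | _, _ => false
  end.

(** Mirror image of [pull_over]: an early layer is moved behind [ys]. *)
Fixpoint push_over (x : layer) (ys : list layer) : list (list layer * layer) :=
  match ys with
  | [] => [([], x)]
  | y :: ys =>
    flat_map (fun p => map (fun q => (fst p :: fst q, snd q)) (push_over (snd p) ys))
      (swaps x y)
  end.

(* The layers [zs], given in reverse order, are followed by [ys]: those on
   which [ys] does not depend are moved after it, to [post]. *)
Fixpoint extract (zs ys post : list layer) : list (list layer * list layer) :=
  match zs with
  | [] => [(ys, post)]
  | z :: zs =>
    match push_over z ys with
    | [] => extract zs (z :: ys) post
    | s => flat_map (fun p => extract zs (fst p) (snd p :: post)) s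
    end
  end.

(** Serves to move what a new match depends on in front of the layers already matched. *)
Fixpoint pull_all (xs ys : list layer) : list (list layer * list layer) :=
  match ys with
  | [] => [([], xs)]
  | y :: ys =>
    flat_map (fun p => map (fun q => (fst p :: fst q, snd q)) (pull_all (snd p) ys))
      (pull_over xs y)
  end.

(** [zs] collects the preceding layers in reverse order, as [extract] expects them. *)
Fixpoint occurrences (k : nat) (zs rest : list layer)
    : list (list layer * layer * list layer) :=
  match rest with
  | [] => []
  | y :: rest =>
    (if gen_of y =? k then [(zs, y, rest)] else []) ++ occurrences k (y :: zs) rest
  end.

(* Looks for the pattern [pat] in the diagram; nothing is proved about the
   search, whose result is checked by [equiv_expr]. The layers in [pre] come before
   the already matched layers [ms], those in [rest] after them, and [ps] is
   the part of [pat] that remains to be matched. *)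
Fixpoint grow (pat ps pre ms rest : list layer)
    : option (list layer * (word * word) * list layer) :=
  match ps with
  | [] =>
    match pat, ms with
    | p :: _, m :: _ =>
      match frame p m with
      | Some (a, b) =>
        if layers_eqb ms (map (whisk a b) pat) then Some (pre, (a, b), rest)
        else None
      | None => None
      end
    | _, _ => None
    end
  | p :: ps =>
    first_some (fun '(zs, y, rest) =>
      first_some (fun '(ys, post) =>
        first_some (fun '(ds, ms) =>
          grow pat ps (pre ++ ds) (ms ++ [last ys y]) (post ++ rest))
          (pull_all ms (removelast ys)))
        (extract zs [y] []))
      (occurrences (gen_of p) [] rest)
  end.

Definition search (pat xs : list layer) :=
  match pat with
  | [] => None
  | p :: ps =>
    first_some (fun '(zs, y, rest) => grow pat ps (List.rev zs) [y] rest)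
      (occurrences (gen_of p) [] xs)
  end.

Definition word_expr (w : word) : oexpr :=
  match w with
  | [] => OUnit
  | i :: w => fold_left (fun a j => OTens a (OAtom j)) w (OAtom i)
  end.

Definition whisk_expr (a b : word) (e : mexpr) : mexpr :=
  let e' := match a with [] => e | _ => MTens (MId (word_expr a)) e end in
  match b with [] => e' | _ => MTens e' (MId (word_expr b)) end.

Definition layer_expr (x : layer) : mexpr :=
  let '(l, k, r) := x in whisk_expr l r (MGen k).

Definition subst_context (pre : list layer) (a b : word) (post : list layer)
    (e : mexpr) : mexpr :=
  let e0 := match pre with
    | [] => whisk_expr a b e
    | x :: pre => MComp (whisk_expr a b e)
        (fold_left (fun f x => MComp (layer_expr x) f) pre (layer_expr x))
    end in
  fold_left (fun f x => MComp (layer_expr x) f) post e0.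

(** The monoidal laws serve to bring [l] into view; replacing it by [r] inside the context is mere
    congruence. *)
Lemma rewrite_expr_den (C : strict_moncat) eo (em : list (mor C)) e l r pre a b post :
  Forall2 (fun f s => hom f (oden eo (fst s)) (oden eo (snd s))) em sg ->
  equiv_expr e (subst_context pre a b post l) = true ->
  mden eo em l = mden eo em r ->
  mden eo em e = mden eo em (subst_context pre a b post r).
Proof.
intros Ht He Hlr; rewrite (equiv_expr_den Ht He); clear He Ht.
unfold subst_context.
set (f := fun f x => MComp (layer_expr x) f).
assert (H : forall t s s', mden eo em s = mden eo em s' ->
  mden eo em (fold_left f t s) = mden eo em (fold_left f t s')).
{ induction t as [|x t IH]; cbn; intros s s' E; [exact E|].
  apply IH; cbn; now rewrite E. }
apply H; destruct pre, a, b; cbn; now rewrite Hlr.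
Qed.

End Layers.

(* A synonym of [hom], by which the tactics recognize the typings they posed. *)
Definition has_type (C : strict_moncat) (f : mor C) (X Y : ob C) := hom f X Y.

(** * Reification of morphisms and the diagrammatic tactics *)

Ltac ob_norm := rewrite ?tens_ob_assoc, ?tens_ob_unit_l, ?tens_ob_unit_r.
Ltac ob_norm_in H :=
  rewrite ?tens_ob_assoc, ?tens_ob_unit_l, ?tens_ob_unit_r in H.

Ltac insert x s :=
  lazymatch s with
  | nil => constr:(cons x s)
  | cons x _ => s
  | cons ?y ?t => let t' := insert x t in constr:(cons y t')
  end.

Ltac index x s :=
  lazymatch s with
  | cons x _ => constr:(O)
  | cons _ ?t => let n := index x t in constr:(S n)
  end.

Ltac ob_atoms X s :=
  lazymatch X with
  | tens_ob ?Y ?Z => let s := ob_atoms Y s in ob_atoms Z s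
  | unit_ob => s
  | _ => insert X s
  end.

Ltac mor_atoms e s :=
  lazymatch e with
  | comp ?g ?f => let s := mor_atoms g s in mor_atoms f s
  | tens ?f ?g => let s := mor_atoms f s in mor_atoms g s
  | idm _ => s
  | _ => insert e s
  end.

Ltac idm_atoms e s :=
  lazymatch e with
  | comp ?g ?f => let s := idm_atoms g s in idm_atoms f s
  | tens ?f ?g => let s := idm_atoms f s in idm_atoms g s
  | idm ?X => ob_atoms X s
  | _ => s
  end.

(** Domains and codomains come from the [hom] hints and are normalized, so that objects equal by
    strictness are reified alike. *)
Ltac pose_types ms :=
  lazymatch ms with
  | nil => idtac
  | cons ?m ?t =>
    let H := fresh "H" in
    eassert (H : hom m _ _) by (eauto 10 with hom);
    ob_norm_in H;
    lazymatch type of H with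
    | hom ?m' ?X ?Y => change (@has_type _ m' X Y) in H
    end;
    pose_types t
  end.

Ltac type_atoms ms s :=
  lazymatch ms with
  | nil => s
  | cons ?m ?t =>
    lazymatch goal with
    | H : @has_type _ m ?X ?Y |- _ =>
      let s := ob_atoms X s in let s := ob_atoms Y s in type_atoms t s
    end
  end.

Ltac reify_ob X eo :=
  lazymatch X with
  | tens_ob ?Y ?Z =>
    let a := reify_ob Y eo in let b := reify_ob Z eo in constr:(OTens a b)
  | unit_ob => constr:(OUnit)
  | _ => let i := index X eo in constr:(OAtom i)
  end.

Ltac reify_mor e eo em :=
  lazymatch e with
  | comp ?g ?f =>
    let g := reify_mor g eo em in let f := reify_mor f eo em in
    constr:(MComp g f)
  | tens ?f ?g =>
    let f := reify_mor f eo em in let g := reify_mor g eo em in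
    constr:(MTens f g)
  | idm ?X => let a := reify_ob X eo in constr:(MId a)
  | _ => let k := index e em in constr:(MGen k)
  end.

Ltac reify_types ms eo :=
  lazymatch ms with
  | nil => constr:(@nil (oexpr * oexpr))
  | cons ?m ?t =>
    lazymatch goal with
    | H : @has_type _ m ?X ?Y |- _ =>
      let a := reify_ob X eo in let b := reify_ob Y eo in
      let s := reify_types t eo in constr:(cons (a, b) s)
    end
  end.

Ltac solve_typed :=
  lazymatch goal with
  | |- Forall2 _ nil _ => apply Forall2_nil
  | |- Forall2 _ (cons ?m _) _ =>
    lazymatch goal with
    | H : @has_type _ m _ _ |- _ => apply Forall2_cons; [exact H | solve_typed]
    end
  end.

Ltac diagram_core a b :=
  lazymatch type of a with
  | mor ?C =>
    let em := mor_atoms a constr:(@nil (mor C)) in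
    let em := mor_atoms b em in
    pose_types em;
    let eo := idm_atoms a constr:(@nil (ob C)) in
    let eo := idm_atoms b eo in
    let eo := type_atoms em eo in
    let sg := reify_types em eo in
    let ea := reify_mor a eo em in
    let eb := reify_mor b eo em in
    change (@mden C eo em ea = @mden C eo em eb);
    apply (@equiv_expr_den sg C eo em); [solve_typed | vm_compute; reflexivity]
  end.

Ltac diagram :=
  ob_norm; lazymatch goal with |- ?a = ?b => diagram_core a b end.

Ltac hom_auto :=
  ob_norm;
  lazymatch goal with
  | |- @hom ?C ?a ?X ?Y =>
    let em := mor_atoms a constr:(@nil (mor C)) in
    pose_types em;
    let eo := idm_atoms a constr:(@nil (ob C)) in
    let eo := ob_atoms X eo in
    let eo := ob_atoms Y eo in
    let eo := type_atoms em eo in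
    let sg := reify_types em eo in
    let ea := reify_mor a eo em in
    let eX := reify_ob X eo in
    let eY := reify_ob Y eo in
    change (hom (@mden C eo em ea) (@oden C eo eX) (@oden C eo eY));
    apply (@type_expr_den sg C eo em); [solve_typed | vm_compute; reflexivity]
  end.

Ltac drw_core a E :=
  lazymatch type of E with
  | @eq (mor ?C) ?l ?r =>
    let em := mor_atoms a constr:(@nil (mor C)) in
    let em := mor_atoms l em in
    let em := mor_atoms r em in
    pose_types em;
    let eo := idm_atoms a constr:(@nil (ob C)) in
    let eo := idm_atoms l eo in
    let eo := idm_atoms r eo in
    let eo := type_atoms em eo in
    let sg := reify_types em eo in
    let ea := reify_mor a eo em in
    let el := reify_mor l eo em in
    let er := reify_mor r eo em in
    let res := eval vm_compute in (search sg (layers sg el) (layers sg ea)) in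
    lazymatch res with
    | Some (?pre, (?u, ?v), ?post) =>
      let t := eval cbv [mden oden subst_context whisk_expr word_expr layer_expr
        fold_left nth] in (@mden C eo em (subst_context pre u v post er)) in
      transitivity t; [|reflexivity];
      apply (@rewrite_expr_den sg C eo em ea el er pre u v post);
      [solve_typed | vm_compute; reflexivity | exact E]
    | None => fail 1 "no occurrence of the left-hand side"
    end
  end.

(** The equation is unfolded before use: the bimonad axioms speak of [fcomp] and [fid], whose
    structures must become visible composites to be reified. *)
Ltac drw_with H :=
  ob_norm; eapply eq_trans;
  [ let E := fresh "E" in pose proof H as E;
    cbv beta delta [fcomp2 fcomp0 fid2 fid0] in E; cbn [far fob fid fcomp] in E;
    rewrite ?far_idm in E; ob_norm_in E;
    lazymatch goal with |- ?a = _ => drw_core a E end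
  | ].

(* [drw H] rewrites with [H] in the left-hand side of the goal, up to the
   equations of strict monoidal categories, and [drwr H] in its right-hand
   side. *)
Tactic Notation "drw" constr(H) := drw_with H.
Tactic Notation "drw" "<-" constr(H) := drw_with (eq_sym H).
Tactic Notation "drwr" constr(H) := symmetry; drw_with H; symmetry.
Tactic Notation "drwr" "<-" constr(H) := symmetry; drw_with (eq_sym H); symmetry.

(** * Duals *)

Section Duals.
Variables (C : strict_moncat) (L : left_duality C) (R : right_duality C).

(** The dual of [f] is [f] with both ends bent, and a zigzag straightens the bend that meets the
    evaluation. The same reason gives the next three sliding rules. *)
Lemma lev_ldual_mor f X Y : hom f X Y ->
  lev L X ∘ ldual_mor L f ⊗ idm X = lev L Y ∘ idm (ldual L Y) ⊗ f.
Proof.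
intros Hf; unfold ldual_mor, ltranspose; destruct (Hf) as [-> ->].
drw (lzigzag1 L X); diagram.
Qed.

Lemma lcoev_ldual_mor f X Y : hom f X Y ->
  idm Y ⊗ ldual_mor L f ∘ lcoev L Y = f ⊗ idm (ldual L X) ∘ lcoev L X.
Proof.
intros Hf; unfold ldual_mor, ltranspose; destruct (Hf) as [-> ->].
drw (lzigzag1 L Y); diagram.
Qed.

Lemma rev_rdual_mor f X Y : hom f X Y ->
  rev R X ∘ idm X ⊗ rdual_mor R f = rev R Y ∘ f ⊗ idm (rdual R Y).
Proof.
intros Hf; unfold rdual_mor, rtranspose; destruct (Hf) as [-> ->].
drw (rzigzag1 R X); diagram.
Qed.

Lemma rcoev_rdual_mor f X Y : hom f X Y ->
  rdual_mor R f ⊗ idm Y ∘ rcoev R Y = idm (rdual R X) ⊗ f ∘ rcoev R X.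
Proof.
intros Hf; unfold rdual_mor, rtranspose; destruct (Hf) as [-> ->].
drw (rzigzag1 R Y); diagram.
Qed.

End Duals.

Lemma natural_hom (C : strict_moncat) (F G : endofunctor C) phi f X Y :
  natural F G phi -> hom f X Y -> phi Y ∘ F⟨f⟩ = G⟨f⟩ ∘ phi X.
Proof. intros [_ H] [<- <-]; apply H. Qed.

Lemma F2_natural_hom (C : strict_moncat) (F : endofunctor C) F2 F0 f g X Y X' Y' :
  is_comonoidal F F2 F0 -> hom f X Y -> hom g X' Y' ->
  F2 Y Y' ∘ F⟨f ⊗ g⟩ = F⟨f⟩ ⊗ F⟨g⟩ ∘ F2 X X'.
Proof. intros H [<- <-] [<- <-]; apply (F2_natural H). Qed.

(** * Factorization through a centralizer *)

Section Centralizer.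
Variables (C : strict_moncat) (L : left_duality C) (T Z : endofunctor C).
Variables (d : ob C -> ob C -> mor C) (Zd : is_centralizer T Z d).

Let hom_d := hom_centralizer Zd.
Local Hint Resolve hom_d : hom.

Lemma centralizer_natural_hom f g X Y X' Y' : hom f X X' -> hom g Y Y' ->
  d X' Y' ∘ f ⊗ g = T⟨g⟩ ⊗ Z⟨f⟩ ∘ d X Y.
Proof. intros [<- <-] [<- <-]; apply (centralizer_natural Zd). Qed.

Lemma centralizer_natural_l f X Y X' : hom f X X' ->
  d X' Y ∘ f ⊗ idm Y = idm (T Y) ⊗ Z⟨f⟩ ∘ d X Y.
Proof. intros Hf; rewrite (centralizer_natural_hom Hf (hom_idm Y)), far_idm; easy. Qed.

Lemma centralizer_natural_r g X Y Y' : hom g Y Y' ->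
  d X Y' ∘ idm X ⊗ g = T⟨g⟩ ⊗ idm (Z X) ∘ d X Y.
Proof. intros Hg; rewrite (centralizer_natural_hom (hom_idm X) Hg), far_idm; easy. Qed.

Lemma centralizer_factor X W xi :
  (forall Y, hom (xi Y) (X ⊗ Y) (T Y ⊗ W)) ->
  (forall g Y Y', hom g Y Y' -> xi Y' ∘ idm X ⊗ g = T⟨g⟩ ⊗ idm W ∘ xi Y) ->
  exists r, hom r (Z X) W /\ forall Y, idm (T Y) ⊗ r ∘ d X Y = xi Y.
Proof.
intros Hxi Nxi.
destruct (centralizer_universal Zd X) as [_ H].
destruct (H W xi) as [r [[Hr E] _]]; [|exists r; split; [exact Hr | now symmetry]].
split; [exact Hxi|]; intros g; apply Nxi; now split.
Qed.
Arguments centralizer_factor X W xi : clear implicits.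

Lemma centralizer_cancel X W r r' : hom r (Z X) W -> hom r' (Z X) W ->
  (forall Y, idm (T Y) ⊗ r ∘ d X Y = idm (T Y) ⊗ r' ∘ d X Y) -> r = r'.
Proof.
intros Hr Hr' E.
destruct (centralizer_universal Zd X) as [_ H].
(* Both maps factor the family of [r], hence both equal its unique factor [q]. *)
destruct (H W (fun Y => idm (T Y) ⊗ r ∘ d X Y)) as [q [_ Hq]].
- split; [intros Y; hom_auto|]; intros g.
  assert (Hg : hom g (dom g) (cod g)) by now split.
  drw (centralizer_natural_r X Hg); diagram.
- now rewrite <- (Hq r), <- (Hq r').
Qed.
Arguments centralizer_cancel X W {r r'}.

(* A map out of [Z X ⊗ V] corresponds by duality to a map out of [Z X]. *)
Lemma centralizer_factor_tens X V W xi :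
  (forall Y, hom (xi Y) (X ⊗ Y ⊗ V) (T Y ⊗ W)) ->
  (forall g Y Y', hom g Y Y' ->
    xi Y' ∘ idm X ⊗ g ⊗ idm V = T⟨g⟩ ⊗ idm W ∘ xi Y) ->
  exists r, hom r (Z X ⊗ V) W /\
    forall Y, idm (T Y) ⊗ r ∘ d X Y ⊗ idm V = xi Y.
Proof.
intros Hxi Nxi.
destruct (centralizer_factor X (W ⊗ ldual L V)
  (fun Y => xi Y ⊗ idm (ldual L V) ∘ idm (X ⊗ Y) ⊗ lcoev L V)) as (r & Hr & E).
- intros Y; hom_auto.
- intros g Y Y' Hg; drwr <- (Nxi g Y Y' Hg); diagram.
- exists (idm W ⊗ lev L V ∘ r ⊗ idm V); split; [hom_auto|]; intros Y.
  drw (E Y); drw (lzigzag1 L V); diagram.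
Qed.
Arguments centralizer_factor_tens X V W xi : clear implicits.

(** A zigzag recovers [r] from its mate [Z X -> W ⊗ ldual L V], to which plain uniqueness
    applies. *)
Lemma centralizer_cancel_tens X V W r r' : hom r (Z X ⊗ V) W -> hom r' (Z X ⊗ V) W ->
  (forall Y, idm (T Y) ⊗ r ∘ d X Y ⊗ idm V = idm (T Y) ⊗ r' ∘ d X Y ⊗ idm V) ->
  r = r'.
Proof.
intros Hr Hr' E.
assert (E' : r ⊗ idm (ldual L V) ∘ idm (Z X) ⊗ lcoev L V =
             r' ⊗ idm (ldual L V) ∘ idm (Z X) ⊗ lcoev L V).
{ apply (centralizer_cancel X (W ⊗ ldual L V)); [hom_auto | hom_auto |].
  intros Y; drw (E Y); diagram. }
transitivity (idm W ⊗ lev L V ∘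
  (r ⊗ idm (ldual L V) ∘ idm (Z X) ⊗ lcoev L V) ⊗ idm V).
- symmetry; drw (lzigzag1 L V); diagram.
- rewrite E'; drw (lzigzag1 L V); diagram.
Qed.
Arguments centralizer_cancel_tens X V W {r r'}.

(** The variables are removed one at a time. For fixed [Y2] the family in [Y1] gives a map
    [q Y2 : Z X ⊗ Y2 -> T Y2 ⊗ W]; by uniqueness [q] is natural, so it factors through [d (Z X)]. *)
Lemma centralizer2_factor X W xi :
  (forall Y1 Y2, hom (xi Y1 Y2) (X ⊗ Y1 ⊗ Y2) (T Y1 ⊗ T Y2 ⊗ W)) ->
  (forall g1 g2 Y1 Y2 Y1' Y2', hom g1 Y1 Y1' -> hom g2 Y2 Y2' ->
    xi Y1' Y2' ∘ idm X ⊗ g1 ⊗ g2 = T⟨g1⟩ ⊗ T⟨g2⟩ ⊗ idm W ∘ xi Y1 Y2) ->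
  exists r, hom r (Z (Z X)) W /\
    forall Y1 Y2, idm (T Y1 ⊗ T Y2) ⊗ r ∘ centralizer2 T Z d X Y1 Y2 = xi Y1 Y2.
Proof.
intros Hxi Nxi.
assert (Hq : forall Y2, exists q, hom q (Z X ⊗ Y2) (T Y2 ⊗ W) /\
  forall Y1, idm (T Y1) ⊗ q ∘ d X Y1 ⊗ idm Y2 = xi Y1 Y2).
{ intros Y2; apply centralizer_factor_tens.
  - intros Y1; rewrite tens_ob_assoc; apply Hxi.
  - intros g Y Y' Hg; drw (Nxi g (idm Y2) _ _ _ _ Hg (hom_idm Y2)).
    diagram. }
apply functional_choice in Hq as [q Hq].
assert (Hq1 := fun Y => proj1 (Hq Y)); assert (Hq2 := fun Y => proj2 (Hq Y)).
clear Hq; cbn beta in *.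
destruct (centralizer_factor (Z X) W q) as (r & Hr & E); [exact Hq1 | |].
- intros g Y Y' Hg.
  apply (centralizer_cancel_tens X Y (T Y' ⊗ W)); [hom_auto | hom_auto |]; intros Y1.
  drwr (Hq2 Y Y1).
  assert (Nq := Nxi (idm Y1) g _ _ _ _ (hom_idm Y1) Hg).
  drwr <- Nq; drwr <- (Hq2 Y' Y1); diagram.
- exists r; split; [exact Hr|]; intros Y1 Y2; unfold centralizer2.
  drw (E Y2); drw (Hq2 Y2 Y1); diagram.
Qed.
Arguments centralizer2_factor X W xi : clear implicits.

Lemma centralizer2_cancel X W r r' : hom r (Z (Z X)) W -> hom r' (Z (Z X)) W ->
  (forall Y1 Y2, idm (T Y1 ⊗ T Y2) ⊗ r ∘ centralizer2 T Z d X Y1 Y2 =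
                 idm (T Y1 ⊗ T Y2) ⊗ r' ∘ centralizer2 T Z d X Y1 Y2) -> r = r'.
Proof.
unfold centralizer2; intros Hr Hr' E.
apply (centralizer_cancel (Z X) W); [easy | easy |]; intros Y2.
apply (centralizer_cancel_tens X Y2 (T Y2 ⊗ W)); [hom_auto | hom_auto |]; intros Y1.
drw (E Y1 Y2); diagram.
Qed.
Arguments centralizer2_cancel X W {r r'}.

End Centralizer.
Arguments centralizer_factor {C T Z d} Zd X W xi _ _.
Arguments centralizer_cancel {C T Z d} Zd X W {r r'} _ _ _.
Arguments centralizer_factor_tens {C} L {T Z d} Zd X V W xi _ _.
Arguments centralizer_cancel_tens {C} L {T Z d} Zd X V W {r r'} _ _ _.
Arguments centralizer2_factor {C} L {T Z d} Zd X W xi _ _.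
Arguments centralizer2_cancel {C} L {T Z d} Zd X W {r r'} _ _ _.

(** * The monad and comonoidal structures of a centralizer *)

Section Structure.
Variables (C : strict_moncat) (L : left_duality C) (T Z : endofunctor C).
Variables (d : ob C -> ob C -> mor C) (Zd : is_centralizer T Z d).

Let hom_d := hom_centralizer Zd.
Local Hint Resolve hom_d : hom.

(** * The monad structure obtained from a comonoidal [T] *)

Section Monad.
Variables (T2 : ob C -> ob C -> mor C) (T0 : mor C).
Hypothesis TC : is_comonoidal T T2 T0.

Let hom_T2 := hom_F2 TC.
Let hom_T0 := hom_F0 TC.
Local Hint Resolve hom_T2 hom_T0 : hom.

Lemma centralizer_mult_exists : exists m, centralizer_mult T Z d T2 m.
Proof.
assert (H : forall X, exists r, hom r (Z (Z X)) (Z X) /\ forall Y1 Y2,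
  idm (T Y1 ⊗ T Y2) ⊗ r ∘ centralizer2 T Z d X Y1 Y2 =
  T2 Y1 Y2 ⊗ idm (Z X) ∘ d X (Y1 ⊗ Y2)%ob).
{ intros X; apply (centralizer2_factor L Zd X (Z X)
    (fun Y1 Y2 => T2 Y1 Y2 ⊗ idm (Z X) ∘ d X (Y1 ⊗ Y2)%ob)).
  - intros Y1 Y2; hom_auto.
  - intros g1 g2 Y1 Y2 Y1' Y2' H1 H2.
    drwr <- (F2_natural_hom TC H1 H2).
    drwr <- (centralizer_natural_r Zd X (hom_tens H1 H2)).
    diagram. }
apply functional_choice in H as [m H].
assert (Hm := fun X => proj1 (H X)); assert (Em := fun X => proj2 (H X)).
clear H; cbn beta in *.
exists m; split; [|exact Em]; split; [exact Hm|]; intros f; cbn.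
assert (Hf : hom f (dom f) (cod f)) by now split.
revert Hf; generalize (dom f) (cod f); intros X X' Hf.
(* Naturality of [m] follows from uniqueness: both sides become [T2 Y1 Y2] after [d X' (Y1 ⊗ Y2)]
   after [f]. *)
apply (centralizer2_cancel L Zd X (Z X')); [hom_auto | hom_auto |].
unfold centralizer2 in *; intros Y1 Y2.
drwr (Em X Y1 Y2); drwr <- (centralizer_natural_l Zd (Y1 ⊗ Y2)%ob Hf).
drw <- (centralizer_natural_l Zd Y2 (hom_far Z Hf)).
drw <- (centralizer_natural_l Zd Y1 Hf).
drw (Em X' Y1 Y2); diagram.
Qed.

Variable m : ob C -> mor C.
Hypothesis Hm : centralizer_mult T Z d T2 m.

Lemma hom_centralizer_mult X : hom (m X) (Z (Z X)) (Z X).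
Proof. apply (proj1 Hm). Qed.
Hint Resolve hom_centralizer_mult : hom.

(** The defining equation with [centralizer2] unfolded, so that [drw] sees its two copies of [d]. *)
Lemma centralizer_mult_d X Y1 Y2 :
  idm (T Y1 ⊗ T Y2) ⊗ m X ∘ idm (T Y1) ⊗ d (Z X) Y2 ∘ d X Y1 ⊗ idm Y2 =
  T2 Y1 Y2 ⊗ idm (Z X) ∘ d X (Y1 ⊗ Y2)%ob.
Proof. rewrite <- (proj2 Hm X Y1 Y2); unfold centralizer2; diagram. Qed.

Lemma centralizer_mult_unique m' : centralizer_mult T Z d T2 m' ->
  forall X, m' X = m X.
Proof.
intros Hm' X; apply (centralizer2_cancel L Zd X (Z X)).
- apply (proj1 Hm').
- apply hom_centralizer_mult.
- intros Y1 Y2; now rewrite (proj2 Hm'), (proj2 Hm).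
Qed.

Let u := centralizer_unit Z d T0.

Lemma hom_centralizer_unit X : hom (u X) X (Z X).
Proof. unfold u, centralizer_unit; hom_auto. Qed.
Hint Resolve hom_centralizer_unit : hom.

Lemma centralizer_unit_natural f X X' : hom f X X' -> u X' ∘ f = Z⟨f⟩ ∘ u X.
Proof.
intros Hf; unfold u, centralizer_unit.
drwr <- (centralizer_natural_l Zd 𝟏%ob Hf); diagram.
Qed.

(** Against three copies of ∂, the two ways of applying [m] split [Y1 ⊗ Y2 ⊗ Y3] in the two ways
    that coassociativity of [T2] identifies. The unit [u (Z X)] sets the second variable to [𝟏] and
    [Z⟨u X⟩] the first, so the left unit law rests on the right counit law and vice versa. *)
Lemma centralizer_monad : is_monad Z m u.
Proof.
split.
- apply Hm.
- split; [apply hom_centralizer_unit|].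
  intros f; apply centralizer_unit_natural; now split.
- intros X.
  apply (centralizer2_cancel L Zd (Z X) (Z X)); [hom_auto | hom_auto |].
  intros Y2 Y3; unfold centralizer2.
  apply (centralizer_cancel_tens L Zd X (Y2 ⊗ Y3) (T Y2 ⊗ T Y3 ⊗ Z X));
    [hom_auto | hom_auto |]; intros Y1.
  drw <- (centralizer_natural_l Zd Y3 (hom_centralizer_mult X)).
  drw (centralizer_mult_d X Y1 Y2); drw (centralizer_mult_d X (Y1 ⊗ Y2)%ob Y3).
  drwr (centralizer_mult_d (Z X) Y2 Y3); drwr (centralizer_mult_d X Y1 (Y2 ⊗ Y3)%ob).
  drwr (F2_coassoc TC Y1 Y2 Y3); diagram.
- intros X; apply (centralizer_cancel Zd X (Z X)); [hom_auto | hom_auto |].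
  intros Y; unfold u, centralizer_unit.
  drw (centralizer_mult_d X Y 𝟏%ob); drw (F2_counit_r TC Y); diagram.
- intros X; apply (centralizer_cancel Zd X (Z X)); [hom_auto | hom_auto |].
  intros Y; drw <- (centralizer_natural_l Zd Y (hom_centralizer_unit X)).
  unfold u, centralizer_unit.
  drw (centralizer_mult_d X 𝟏%ob Y); drw (F2_counit_l TC Y); diagram.
Qed.

End Monad.

(** * The comonoidal structure obtained from a monad [T] *)

Section Comonoidal.
Variables mu eta : ob C -> mor C.
Hypothesis TM : is_monad T mu eta.

Lemma hom_mu X : hom (mu X) (T (T X)) (T X).
Proof. apply (proj1 (mu_natural TM)). Qed.
Lemma hom_eta X : hom (eta X) X (T X).
Proof. apply (proj1 (eta_natural TM)). Qed.
Hint Resolve hom_mu hom_eta : hom.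

Lemma centralizer_comult_exists : exists Z2, centralizer_comult T Z d mu Z2.
Proof.
(* Pairs are used because [functional_choice] yields functions of one variable. *)
assert (H : forall p : ob C * ob C, exists r,
  hom r (Z (fst p ⊗ snd p)%ob) (Z (fst p) ⊗ Z (snd p)) /\ forall Y,
  idm (T Y) ⊗ r ∘ d (fst p ⊗ snd p)%ob Y =
  mu Y ⊗ idm (Z (fst p) ⊗ Z (snd p)) ∘ d (fst p) (T Y) ⊗ idm (Z (snd p))
    ∘ idm (fst p) ⊗ d (snd p) Y).
{ intros [X1 X2]; cbn; apply (centralizer_factor Zd).
  - intros Y; hom_auto.
  - intros g Y Y' Hg.
    drwr <- (natural_hom (mu_natural TM) Hg).
    drwr <- (centralizer_natural_r Zd X1 (hom_far T Hg)).
    drwr <- (centralizer_natural_r Zd X2 Hg); diagram. }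
apply functional_choice in H as [Z2' H].
pose (Z2 X1 X2 := Z2' (X1, X2)).
assert (HZ : forall X1 X2, hom (Z2 X1 X2) (Z (X1 ⊗ X2)%ob) (Z X1 ⊗ Z X2))
  by (intros X1 X2; apply (H (X1, X2))).
assert (EZ : forall X1 X2 Y, idm (T Y) ⊗ Z2 X1 X2 ∘ d (X1 ⊗ X2)%ob Y =
  mu Y ⊗ idm (Z X1 ⊗ Z X2) ∘ d X1 (T Y) ⊗ idm (Z X2) ∘ idm X1 ⊗ d X2 Y)
  by (intros X1 X2; apply (H (X1, X2))).
clearbody Z2; clear H Z2'.
exists Z2; split; [exact HZ|]; split; [|exact EZ].
intros f g.
assert (Hf : hom f (dom f) (cod f)) by now split.
assert (Hg : hom g (dom g) (cod g)) by now split.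
revert Hf Hg; generalize (dom f) (cod f) (dom g) (cod g); intros X X' W W' Hf Hg.
apply (centralizer_cancel Zd (X ⊗ W) (Z X' ⊗ Z W')); [hom_auto | hom_auto |].
intros Y.
drw <- (centralizer_natural_l Zd Y (hom_tens Hf Hg)).
drw (EZ X' W' Y); drwr (EZ X W Y).
drwr <- (centralizer_natural_l Zd (T Y) Hf).
drwr <- (centralizer_natural_l Zd Y Hg); diagram.
Qed.

Lemma centralizer_counit_exists : exists Z0, centralizer_counit T Z d eta Z0.
Proof.
destruct (centralizer_factor Zd 𝟏%ob 𝟏%ob eta) as (r & Hr & E).
- intros Y; hom_auto.
- intros g Y Y' Hg; drw (natural_hom (eta_natural TM) Hg).
  diagram.
- exists r; split; assumption.
Qed.

Lemma centralizer_comult_unique Z2 Z2' :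
  centralizer_comult T Z d mu Z2 -> centralizer_comult T Z d mu Z2' ->
  forall X1 X2, Z2' X1 X2 = Z2 X1 X2.
Proof.
intros (H & _ & E) (H' & _ & E') X1 X2.
apply (centralizer_cancel Zd (X1 ⊗ X2) (Z X1 ⊗ Z X2)); [apply H' | apply H |].
intros Y; now rewrite E, E'.
Qed.

Lemma centralizer_counit_unique Z0 Z0' :
  centralizer_counit T Z d eta Z0 -> centralizer_counit T Z d eta Z0' -> Z0' = Z0.
Proof.
intros (H & E) (H' & E'); apply (centralizer_cancel Zd _ _ H' H).
intros Y; now rewrite E, E'.
Qed.

Variables (Z2 : ob C -> ob C -> mor C) (Z0 : mor C).
Hypothesis HZ2 : centralizer_comult T Z d mu Z2.
Hypothesis HZ0 : centralizer_counit T Z d eta Z0.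

Lemma hom_centralizer_comult X1 X2 : hom (Z2 X1 X2) (Z (X1 ⊗ X2)%ob) (Z X1 ⊗ Z X2).
Proof. apply HZ2. Qed.
Lemma hom_centralizer_counit : hom Z0 (Z 𝟏%ob) 𝟏.
Proof. apply HZ0. Qed.
Hint Resolve hom_centralizer_comult hom_centralizer_counit : hom.

Let Z2_d := proj2 (proj2 HZ2).
Let Z0_d := proj2 HZ0.

(** In [Z2_d] the map [d X2 Y] acts first, so [d X1] acts at [T Y]; three factors produce the two
    ways of multiplying [T (T (T V))]. A counit on the right puts [eta Y] under [T] and one on the
    left gives [eta (T Y)], which are the two unit laws of [mu]. *)
Lemma centralizer_comonoidal : is_comonoidal Z Z2 Z0.
Proof.
split.
- exact hom_centralizer_comult.
- apply HZ2.
- exact hom_centralizer_counit.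
- intros X Y W.
  apply (centralizer_cancel Zd (X ⊗ Y ⊗ W) (Z X ⊗ Z Y ⊗ Z W));
    [hom_auto | hom_auto |]; intros V.
  drw (Z2_d X (Y ⊗ W)%ob V); drw (Z2_d Y W V).
  drw (centralizer_natural_r Zd X (hom_mu V)); drw (mu_assoc TM V).
  drwr (Z2_d (X ⊗ Y)%ob W V); drwr (Z2_d X Y (T V)); diagram.
- intros X; apply (centralizer_cancel Zd X (Z X)); [hom_auto | hom_auto |].
  intros Y; drw (Z2_d X 𝟏%ob Y); drw (Z0_d Y).
  drw (centralizer_natural_r Zd X (hom_eta Y)); drw (mu_eta_r TM Y).
  diagram.
- intros X; apply (centralizer_cancel Zd X (Z X)); [hom_auto | hom_auto |].
  intros Y; drw (Z2_d 𝟏%ob X Y); drw (Z0_d (T Y)); drw (mu_eta_l TM Y); diagram.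
Qed.

End Comonoidal.

(** * Compatibility of the two structures *)

Section Bimonad.
Variables (mu eta : ob C -> mor C) (T2 : ob C -> ob C -> mor C) (T0 : mor C).
Hypothesis TB : is_bimonad T mu eta T2 T0.
Variables (m : ob C -> mor C) (Z2 : ob C -> ob C -> mor C) (Z0 : mor C).
Hypothesis Hm : centralizer_mult T Z d T2 m.
Hypothesis HZ2 : centralizer_comult T Z d mu Z2.
Hypothesis HZ0 : centralizer_counit T Z d eta Z0.

Let TM := bimonad_monad TB.
Let TC := bimonad_comonoidal TB.
Let hom_T2 := hom_F2 TC.
Let hom_T0 := hom_F0 TC.
Let hom_mu := hom_mu TM.
Let hom_eta := hom_eta TM.
Let hom_m := hom_centralizer_mult Hm.
Let hom_Z2 := hom_centralizer_comult HZ2.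
Let hom_Z0 := hom_centralizer_counit HZ0.
Local Hint Resolve hom_T2 hom_T0 hom_mu hom_eta hom_m hom_Z2 hom_Z0 : hom.
Let m_d := centralizer_mult_d Hm.
Let Z2_d := proj2 (proj2 HZ2).
Let Z0_d := proj2 HZ0.

Let u := centralizer_unit Z d T0.

(** The four compatibilities are transposed: [m] with [Z2] comes from [mu] with [T2], [m] with [Z0]
    from [eta] with [T2], [u] with [Z2] from [mu] with [T0], and [u] with [Z0] from [eta] with
    [T0]. *)
Lemma centralizer_bimonad : is_bimonad Z m u Z2 Z0.
Proof.
assert (ZM : is_monad Z m u) by exact (centralizer_monad TC Hm).
split; [exact ZM | apply (centralizer_comonoidal TM HZ2 HZ0) | |].
- split; [apply Hm | intros X1 X2 | ]; unfold fcomp2, fcomp0; cbn.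
  + apply (centralizer2_cancel L Zd (X1 ⊗ X2) (Z X1 ⊗ Z X2));
      [hom_auto | hom_auto |].
    intros Y1 Y2; unfold centralizer2.
    drw (m_d (X1 ⊗ X2)%ob Y1 Y2); drw (Z2_d X1 X2 (Y1 ⊗ Y2)%ob).
    drw (comonoidal_nat_2 (bimonad_mu TB) Y1 Y2).
    drwr <- (centralizer_natural_l Zd Y2 (hom_Z2 X1 X2)).
    drwr (Z2_d X1 X2 Y1); drwr (Z2_d (Z X1) (Z X2) Y2).
    drwr (m_d X2 Y1 Y2); drwr (m_d X1 (T Y1) (T Y2)).
    (* This produces [T2 (T Y1) (T Y2) ∘ T⟨T2 Y1 Y2⟩], the comonoidal structure of [T] composed with
       itself. *)
    drwr (centralizer_natural_r Zd X1 (hom_T2 Y1 Y2)).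
    diagram.
  + apply (centralizer2_cancel L Zd 𝟏%ob 𝟏%ob); [hom_auto | hom_auto |].
    intros Y1 Y2; unfold centralizer2.
    drw (m_d 𝟏%ob Y1 Y2); drw (Z0_d (Y1 ⊗ Y2)%ob).
    drw (comonoidal_nat_2 (bimonad_eta TB) Y1 Y2).
    drwr <- (centralizer_natural_l Zd Y2 hom_Z0).
    drwr (Z0_d Y1); drwr (Z0_d Y2); diagram.
- split; [apply ZM | intros X1 X2 | ]; unfold u, centralizer_unit, fid2, fid0.
  + drw (Z2_d X1 X2 𝟏%ob); drw (comonoidal_nat_0 (bimonad_mu TB)).
    drw <- (centralizer_natural_r Zd X1 hom_T0); diagram.
  + drw (Z0_d 𝟏%ob); drw (comonoidal_nat_0 (bimonad_eta TB)).
    diagram.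
Qed.

End Bimonad.
End Structure.

(** * Antipodes of a centralizer *)

Section Bending.
Variables (C : strict_moncat) (L : left_duality C) (R : right_duality C).

(* The left dual [ldual W ⊗ Y -> A ⊗ ldual X] of
   [g : X ⊗ rdual A -> rdual Y ⊗ W], without the canonical isomorphisms. *)
Definition lbend (X A Y W : ob C) (g : mor C) : mor C :=
  lev L W ⊗ idm (A ⊗ ldual L X)
  ∘ idm (ldual L W) ⊗ rev R Y ⊗ idm (W ⊗ A ⊗ ldual L X)
  ∘ idm (ldual L W ⊗ Y) ⊗ g ⊗ idm (A ⊗ ldual L X)
  ∘ idm (ldual L W ⊗ Y ⊗ X) ⊗ rcoev R A ⊗ idm (ldual L X)
  ∘ idm (ldual L W ⊗ Y) ⊗ lcoev L X.

(* The right dual [rdual W ⊗ Y -> A ⊗ rdual X] of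
   [g : X ⊗ ldual A -> ldual Y ⊗ W]. *)
Definition rbend (X A Y W : ob C) (g : mor C) : mor C :=
  idm (A ⊗ rdual R X) ⊗ lev L Y
  ∘ idm (A ⊗ rdual R X ⊗ ldual L Y) ⊗ rev R W ⊗ idm Y
  ∘ idm (A ⊗ rdual R X) ⊗ g ⊗ idm (rdual R W ⊗ Y)
  ∘ idm A ⊗ rcoev R X ⊗ idm (ldual L A ⊗ rdual R W ⊗ Y)
  ∘ lcoev L A ⊗ idm (rdual R W ⊗ Y).

(** Five transposes meet in four chosen left duals, and a zigzag removes each of them. *)
Lemma lbend_ldual_mor X A Y W g : hom g (X ⊗ rdual R A) (rdual R Y ⊗ W) ->
  of_ldual_rdual L R A ⊗ idm (ldual L X)
    ∘ ldual_tens_inv L X (rdual R A) ∘ ldual_mor L g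
    ∘ ldual_tens L (rdual R Y) W ∘ idm (ldual L W) ⊗ to_ldual_rdual L R Y =
  lbend X A Y W g.
Proof.
intros Hg; unfold of_ldual_rdual, to_ldual_rdual, ldual_tens, ldual_tens_inv,
  ldual_mor, lev_tens, lcoev_tens, ltranspose, lbend.
destruct (Hg) as [-> ->].
drw (lzigzag1 L (rdual R Y)); drw (lzigzag1 L (rdual R Y ⊗ W)%ob).
drw (lzigzag1 L (X ⊗ rdual R A)%ob); drw (lzigzag1 L (rdual R A)); diagram.
Qed.

Lemma rbend_rdual_mor X A Y W g : hom g (X ⊗ ldual L A) (ldual L Y ⊗ W) ->
  of_rdual_ldual L R A ⊗ idm (rdual R X)
    ∘ rdual_tens_inv R X (ldual L A) ∘ rdual_mor R g
    ∘ rdual_tens R (ldual L Y) W ∘ idm (rdual R W) ⊗ to_rdual_ldual L R Y =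
  rbend X A Y W g.
Proof.
intros Hg; unfold of_rdual_ldual, to_rdual_ldual, rdual_tens, rdual_tens_inv,
  rdual_mor, rev_tens, rcoev_tens, rtranspose, rbend.
destruct (Hg) as [-> ->].
drw (rzigzag1 R (ldual L Y)); drw (rzigzag1 R (ldual L Y ⊗ W)%ob).
drw (rzigzag1 R (X ⊗ ldual L A)%ob); drw (rzigzag1 R (ldual L A)); diagram.
Qed.

End Bending.

Section Antipodes.
Variables (C : strict_moncat) (L : left_duality C) (R : right_duality C).
Variables (T Z : endofunctor C).
Variables (d : ob C -> ob C -> mor C) (Zd : is_centralizer T Z d).
Variables (mu eta : ob C -> mor C) (T2 : ob C -> ob C -> mor C) (T0 : mor C).
Hypothesis TB : is_bimonad T mu eta T2 T0.
Variables (m : ob C -> mor C) (Z2 : ob C -> ob C -> mor C) (Z0 : mor C).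
Hypothesis Hm : centralizer_mult T Z d T2 m.
Hypothesis HZ2 : centralizer_comult T Z d mu Z2.
Hypothesis HZ0 : centralizer_counit T Z d eta Z0.

Let TM := bimonad_monad TB.
Let TC := bimonad_comonoidal TB.
Let hom_d := hom_centralizer Zd.
Let hom_T2 := hom_F2 TC.
Let hom_T0 := hom_F0 TC.
Let hom_mu := hom_mu TM.
Let hom_eta := hom_eta TM.
Let hom_m := hom_centralizer_mult Hm.
Let hom_Z2 := hom_centralizer_comult HZ2.
Let hom_Z0 := hom_centralizer_counit HZ0.
Let m_d := centralizer_mult_d Zd Hm.
Let Z2_d := proj2 (proj2 HZ2).
Let Z0_d := proj2 HZ0.
Let u := centralizer_unit Z d T0.
Let hom_u : forall X, hom (u X) X (Z X) := hom_centralizer_unit Zd TC.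
Local Hint Resolve hom_d hom_T2 hom_T0 hom_mu hom_eta hom_m hom_Z2 hom_Z0 hom_u
  : hom.

(** * The left antipode obtained from a right antipode of [T] *)

Section Left.
Variable sr : ob C -> mor C.
Hypothesis Hsr : is_right_antipode R T mu eta T2 T0 sr.

Let hom_sr := hom_right_antipode Hsr.
Local Hint Resolve hom_sr : hom.

Let G X Y :=
  lbend L R X (T Y) Y (Z X) (sr Y ⊗ idm (Z X) ∘ d X (rdual R (T Y))).

(** This trades the canonical isomorphisms for the bent form [G], whose evaluations and
    coevaluations can be rewritten one by one. *)
Lemma centralizer_left_antipodeE S :
  centralizer_left_antipode T Z d L R sr S <->
  (forall X, hom (S X) (Z (ldual L (Z X))) (ldual L X)) /\
  (forall f,
    ldual_mor L f ∘ S (cod f) = S (dom f) ∘ Z⟨ldual_mor L (Z⟨f⟩)⟩) /\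
  forall X Y, idm (T Y) ⊗ S X ∘ d (ldual L (Z X)) Y = G X Y.
Proof.
assert (E : forall X Y, of_ldual_rdual L R (T Y) ⊗ idm (ldual L X)
      ∘ ldual_tens_inv L X (rdual R (T Y))
      ∘ ldual_mor L ((sr Y ⊗ idm (Z X)) ∘ d X (rdual R (T Y)))
      ∘ ldual_tens L (rdual R Y) (Z X)
      ∘ (idm (ldual L (Z X)) ⊗ to_ldual_rdual L R Y) = G X Y)
  by (intros X Y; apply lbend_ldual_mor; hom_auto).
unfold centralizer_left_antipode.
split; intros (H1 & H2 & H3); repeat split; try apply H1; try apply H2;
  intros X Y; [rewrite <- E | rewrite E]; apply H3.
Qed.

Lemma centralizer_left_antipode_exists :
  exists S, centralizer_left_antipode T Z d L R sr S.
Proof.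
assert (H : forall X, exists r, hom r (Z (ldual L (Z X))) (ldual L X) /\
  forall Y, idm (T Y) ⊗ r ∘ d (ldual L (Z X)) Y = G X Y).
{ intros X; apply (centralizer_factor Zd (ldual L (Z X)) (ldual L X) (G X));
    unfold G, lbend.
  - intros Y; hom_auto.
  (* Both sides are brought to [sr Y] after [T⟨rdual_mor R (T⟨f⟩)⟩]: on the left [f] slides over
     [rev] and through [sr], on the right [T⟨f⟩] slides over [rcoev] and through ∂. *)
  - intros f Y Y' Hf; drw <- (rev_rdual_mor R Hf).
    assert (Nf := right_antipode_natural Hsr f); destruct (Hf) as [Ed Ec].
    rewrite Ed, Ec in Nf; drw Nf; clear Nf Ed Ec.
    assert (HTf := hom_far T Hf).
    drwr <- (rcoev_rdual_mor R HTf).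
    drwr (centralizer_natural_r Zd X (hom_rdual R HTf)); diagram. }
apply functional_choice in H as [S H].
assert (HS : forall X, hom (S X) (Z (ldual L (Z X))) (ldual L X)) by apply H.
assert (ES : forall X Y, idm (T Y) ⊗ S X ∘ d (ldual L (Z X)) Y = G X Y)
  by apply H.
clear H; exists S; apply centralizer_left_antipodeE.
split; [exact HS|]; split; [|exact ES]; intros f; unfold G, lbend in ES.
assert (Hf : hom f (dom f) (cod f)) by now split.
revert Hf; generalize (dom f) (cod f); intros X X' Hf.
assert (HZf := hom_far Z Hf).
apply (centralizer_cancel Zd (ldual L (Z X')) (ldual L X)); [hom_auto | hom_auto |].
intros Y; drw (ES X' Y).
drwr <- (centralizer_natural_l Zd Y (hom_ldual L HZf)); drwr (ES X Y).
drwr (lev_ldual_mor L HZf); drwr <- (centralizer_natural_l Zd (rdual R (T Y)) Hf).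
drw (lcoev_ldual_mor L Hf); diagram.
Qed.

Lemma centralizer_left_antipode_unique S S' :
  centralizer_left_antipode T Z d L R sr S ->
  centralizer_left_antipode T Z d L R sr S' -> forall X, S' X = S X.
Proof.
intros (H & _ & E) (H' & _ & E') X.
apply (centralizer_cancel Zd (ldual L (Z X)) (ldual L X)); [apply H' | apply H |].
intros Y; now rewrite E, E'.
Qed.

(** Each axiom comes from the axiom of the same kind for [sr]. With the dual as first factor of
    [Z2], the antipode is met at [T Y], as in the evaluation axiom; with the dual second, it is met
    at [Y], as in the coevaluation axiom. *)
Lemma centralizer_left_antipodeP S :
  centralizer_left_antipode T Z d L R sr S ->
  is_left_antipode L Z m u Z2 Z0 S.
Proof.
intros (hom_S & NS & S_d)%centralizer_left_antipodeE.
split; [exact hom_S | exact NS | |]; intros X; unfold G, lbend in S_d.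
- apply (centralizer_cancel Zd (ldual L (Z X) ⊗ X) 𝟏%ob); [hom_auto | hom_auto |].
  intros Y.
  drw <- (centralizer_natural_l Zd Y (hom_tens (hom_ldual L (hom_u X)) (hom_idm X))).
  drw <- (centralizer_natural_l Zd Y (hom_lev L X)).
  drw (Z0_d Y); drw (lev_ldual_mor L (hom_u X)).
  drwr (Z2_d (ldual L (Z X)) X Y).
  drwr <- (centralizer_natural_l Zd (T Y) (hom_ldual L (hom_m X))).
  drwr (S_d (Z X) (T Y)).
  drwr (lev_ldual_mor L (hom_m X)); drwr (lzigzag1 L (Z X)).
  (* [mu Y] slides over the coevaluation and becomes its dual, the form in which the antipode axiom
     contains it. *)
  drwr <- (rcoev_rdual_mor R (hom_mu Y)).
  drwr (m_d X Y (rdual R (T (T Y)))).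
  assert (Hmu := hom_rdual R (hom_mu Y)); assert (Heta := hom_rdual R (hom_eta Y)).
  drwr (centralizer_natural_r Zd X (hom_tens (hom_idm Y) Hmu)).
  drwr (F2_natural_hom TC (hom_idm Y) Hmu).
  drwr <- (right_antipode_ev Hsr Y).
  (* The dual of [eta Y] and [rev R Y] pass to the source of ∂, which leaves [d X 𝟏] under [T0],
     that is, [u X]. *)
  drwr <- (centralizer_natural_r Zd X (hom_tens (hom_idm Y) Heta)).
  drwr <- (centralizer_natural_r Zd X (hom_rev R Y)).
  drwr (rcoev_rdual_mor R (hom_eta Y)); drwr (rzigzag1 R Y).
  unfold u, centralizer_unit; diagram.
- apply (centralizer_cancel Zd 𝟏%ob (Z X ⊗ ldual L X)); [hom_auto | hom_auto |].
  intros Y; drw (Z0_d Y).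
  drwr <- (centralizer_natural_l Zd Y (hom_lcoev L (Z X))).
  drwr (Z2_d (Z X) (ldual L (Z X)) Y); drwr (S_d X Y).
  (* The zigzag makes the ∂ bent by [S] and the ∂ of [Z2] consecutive, so that [m] merges them and
     [rcoev R (T Y)] can move inside [T]. *)
  drwr (lzigzag1 L (Z X)); drwr (m_d X (rdual R (T Y)) (T Y)).
  drwr (centralizer_natural_r Zd X (hom_rcoev R (T Y))).
  drwr <- (right_antipode_coev Hsr Y); drwr (rzigzag1 R Y).
  unfold u, centralizer_unit; diagram.
Qed.

End Left.

(** * The right antipode obtained from a left antipode of [T] *)

Section Right.
Variable sl : ob C -> mor C.
Hypothesis Hsl : is_left_antipode L T mu eta T2 T0 sl.

Let hom_sl := hom_left_antipode Hsl.
Local Hint Resolve hom_sl : hom.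

Let G X Y :=
  rbend L R X (T Y) Y (Z X) (sl Y ⊗ idm (Z X) ∘ d X (ldual L (T Y))).

Lemma centralizer_right_antipodeE S :
  centralizer_right_antipode T Z d L R sl S <->
  (forall X, hom (S X) (Z (rdual R (Z X))) (rdual R X)) /\
  (forall f,
    rdual_mor R f ∘ S (cod f) = S (dom f) ∘ Z⟨rdual_mor R (Z⟨f⟩)⟩) /\
  forall X Y, idm (T Y) ⊗ S X ∘ d (rdual R (Z X)) Y = G X Y.
Proof.
assert (E : forall X Y, of_rdual_ldual L R (T Y) ⊗ idm (rdual R X)
      ∘ rdual_tens_inv R X (ldual L (T Y))
      ∘ rdual_mor R ((sl Y ⊗ idm (Z X)) ∘ d X (ldual L (T Y)))
      ∘ rdual_tens R (ldual L Y) (Z X)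
      ∘ (idm (rdual R (Z X)) ⊗ to_rdual_ldual L R Y) = G X Y)
  by (intros X Y; apply rbend_rdual_mor; hom_auto).
unfold centralizer_right_antipode.
split; intros (H1 & H2 & H3); repeat split; try apply H1; try apply H2;
  intros X Y; [rewrite <- E | rewrite E]; apply H3.
Qed.

Lemma centralizer_right_antipode_exists :
  exists S, centralizer_right_antipode T Z d L R sl S.
Proof.
assert (H : forall X, exists r, hom r (Z (rdual R (Z X))) (rdual R X) /\
  forall Y, idm (T Y) ⊗ r ∘ d (rdual R (Z X)) Y = G X Y).
{ intros X; apply (centralizer_factor Zd (rdual R (Z X)) (rdual R X) (G X));
    unfold G, rbend.
  - intros Y; hom_auto.
  - intros f Y Y' Hf; drw <- (lev_ldual_mor L Hf).
    assert (Nf := left_antipode_natural Hsl f); destruct (Hf) as [Ed Ec].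
    rewrite Ed, Ec in Nf; drw Nf; clear Nf Ed Ec.
    assert (HTf := hom_far T Hf).
    drwr <- (lcoev_ldual_mor L HTf).
    drwr (centralizer_natural_r Zd X (hom_ldual L HTf)); diagram. }
apply functional_choice in H as [S H].
assert (HS : forall X, hom (S X) (Z (rdual R (Z X))) (rdual R X)) by apply H.
assert (ES : forall X Y, idm (T Y) ⊗ S X ∘ d (rdual R (Z X)) Y = G X Y)
  by apply H.
clear H; exists S; apply centralizer_right_antipodeE.
split; [exact HS|]; split; [|exact ES]; intros f; unfold G, rbend in ES.
assert (Hf : hom f (dom f) (cod f)) by now split.
revert Hf; generalize (dom f) (cod f); intros X X' Hf.
assert (HZf := hom_far Z Hf).
apply (centralizer_cancel Zd (rdual R (Z X')) (rdual R X)); [hom_auto | hom_auto |].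
intros Y; drw (ES X' Y).
drwr <- (centralizer_natural_l Zd Y (hom_rdual R HZf)); drwr (ES X Y).
drwr (rev_rdual_mor R HZf); drwr <- (centralizer_natural_l Zd (ldual L (T Y)) Hf).
drw (rcoev_rdual_mor R Hf); diagram.
Qed.

Lemma centralizer_right_antipode_unique S S' :
  centralizer_right_antipode T Z d L R sl S ->
  centralizer_right_antipode T Z d L R sl S' -> forall X, S' X = S X.
Proof.
intros (H & _ & E) (H' & _ & E') X.
apply (centralizer_cancel Zd (rdual R (Z X)) (rdual R X)); [apply H' | apply H |].
intros Y; now rewrite E, E'.
Qed.

(** Here the axioms are interchanged: in the evaluation axiom the dual is now the second factor of
    [Z2], so the antipode is met at [Y] with [mu] outside it, as in the coevaluation axiom of [sl];
    the other axiom likewise comes from evaluation. *)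
Lemma centralizer_right_antipodeP S :
  centralizer_right_antipode T Z d L R sl S ->
  is_right_antipode R Z m u Z2 Z0 S.
Proof.
intros (hom_S & NS & S_d)%centralizer_right_antipodeE.
split; [exact hom_S | exact NS | |]; intros X; unfold G, rbend in S_d.
- apply (centralizer_cancel Zd (X ⊗ rdual R (Z X)) 𝟏%ob); [hom_auto | hom_auto |].
  intros Y.
  drw <- (centralizer_natural_l Zd Y (hom_tens (hom_idm X) (hom_rdual R (hom_u X)))).
  drw <- (centralizer_natural_l Zd Y (hom_rev R X)).
  drw (Z0_d Y); drw (rev_rdual_mor R (hom_u X)).
  drwr (Z2_d X (rdual R (Z X)) Y).
  drwr <- (centralizer_natural_l Zd Y (hom_rdual R (hom_m X))).
  drwr (S_d (Z X) Y).
  drwr (rev_rdual_mor R (hom_m X)); drwr (rzigzag1 R (Z X)).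
  (* The ∂ at [T Y] from [Z2] and the ∂ at [ldual L (T Y)] from [S] merge, and the coevaluation
     between them moves inside [T]. *)
  drwr (m_d X (T Y) (ldual L (T Y))).
  drwr (centralizer_natural_r Zd X (hom_lcoev L (T Y))).
  drwr <- (left_antipode_coev Hsl Y); drwr (lzigzag1 L Y).
  unfold u, centralizer_unit; diagram.
- apply (centralizer_cancel Zd 𝟏%ob (rdual R X ⊗ Z X)); [hom_auto | hom_auto |].
  intros Y; drw (Z0_d Y).
  drwr <- (centralizer_natural_l Zd Y (hom_rcoev R (Z X))).
  drwr (Z2_d (rdual R (Z X)) (Z X) Y); drwr (S_d X (T Y)).
  drwr (rzigzag1 R (Z X)); drwr <- (lcoev_ldual_mor L (hom_mu Y)).
  drwr (m_d X (ldual L (T (T Y))) Y).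
  assert (Hmu := hom_ldual L (hom_mu Y)); assert (Heta := hom_ldual L (hom_eta Y)).
  drwr (centralizer_natural_r Zd X (hom_tens Hmu (hom_idm Y))).
  drwr (F2_natural_hom TC Hmu (hom_idm Y)).
  drwr <- (left_antipode_ev Hsl Y).
  drwr <- (centralizer_natural_r Zd X (hom_tens Heta (hom_idm Y))).
  drwr <- (centralizer_natural_r Zd X (hom_lev L Y)).
  drwr (lcoev_ldual_mor L (hom_eta Y)); drwr (lzigzag1 L Y).
  unfold u, centralizer_unit; diagram.
Qed.

End Right.
End Antipodes.

Theorem theorem5p6 (C : strict_moncat) (L : left_duality C)
  (T Z : endofunctor C) (d : ob C -> ob C -> mor C)
  (Zd : is_centralizer T Z d) :
  (* (a) *)
  (forall T2 T0, is_comonoidal T T2 T0 ->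
    (exists m, centralizer_mult T Z d T2 m /\
      (forall m', centralizer_mult T Z d T2 m' -> forall X, m' X = m X) /\
      is_monad Z m (centralizer_unit Z d T0)))
  /\
  (* (b) *)
  (forall mu eta, is_monad T mu eta ->
    (exists Z2 Z0,
      centralizer_comult T Z d mu Z2 /\
      (forall Z2', centralizer_comult T Z d mu Z2' ->
        forall X1 X2, Z2' X1 X2 = Z2 X1 X2) /\
      centralizer_counit T Z d eta Z0 /\
      (forall Z0', centralizer_counit T Z d eta Z0' -> Z0' = Z0) /\
      is_comonoidal Z Z2 Z0))
  /\
  (* (c) *)
  (forall mu eta T2 T0, is_bimonad T mu eta T2 T0 ->
    forall m Z2 Z0,
      centralizer_mult T Z d T2 m ->
      centralizer_comult T Z d mu Z2 ->
      centralizer_counit T Z d eta Z0 ->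
      is_bimonad Z m (centralizer_unit Z d T0) Z2 Z0)
  /\
  (* (d) *)
  (forall (R : right_duality C) mu eta T2 T0 sr,
    is_bimonad T mu eta T2 T0 ->
    is_right_antipode R T mu eta T2 T0 sr ->
    forall m Z2 Z0,
      centralizer_mult T Z d T2 m ->
      centralizer_comult T Z d mu Z2 ->
      centralizer_counit T Z d eta Z0 ->
      exists Sl, centralizer_left_antipode T Z d L R sr Sl /\
        (forall Sl', centralizer_left_antipode T Z d L R sr Sl' ->
          forall X, Sl' X = Sl X) /\
        is_left_antipode L Z m (centralizer_unit Z d T0) Z2 Z0 Sl)
  /\
  (* (e) *)
  (forall (R : right_duality C) mu eta T2 T0 sl,
    is_bimonad T mu eta T2 T0 ->
    is_left_antipode L T mu eta T2 T0 sl ->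
    forall m Z2 Z0,
      centralizer_mult T Z d T2 m ->
      centralizer_comult T Z d mu Z2 ->
      centralizer_counit T Z d eta Z0 ->
      exists Sr, centralizer_right_antipode T Z d L R sl Sr /\
        (forall Sr', centralizer_right_antipode T Z d L R sl Sr' ->
          forall X, Sr' X = Sr X) /\
        is_right_antipode R Z m (centralizer_unit Z d T0) Z2 Z0 Sr)
  /\
  (* in particular *)
  (forall (R : right_duality C) mu eta T2 T0,
    is_hopf_monad L R T mu eta T2 T0 ->
    forall m Z2 Z0,
      centralizer_mult T Z d T2 m ->
      centralizer_comult T Z d mu Z2 ->
      centralizer_counit T Z d eta Z0 ->
      is_hopf_monad L R Z m (centralizer_unit Z d T0) Z2 Z0).
Proof.
(* Both antipode statements are established beforehand because the claim on Hopf monads uses them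
   again. *)
assert (Hd : forall (R : right_duality C) mu eta T2 T0 sr,
  is_bimonad T mu eta T2 T0 -> is_right_antipode R T mu eta T2 T0 sr ->
  forall m Z2 Z0, centralizer_mult T Z d T2 m ->
    centralizer_comult T Z d mu Z2 -> centralizer_counit T Z d eta Z0 ->
    exists Sl, centralizer_left_antipode T Z d L R sr Sl /\
      (forall Sl', centralizer_left_antipode T Z d L R sr Sl' ->
        forall X, Sl' X = Sl X) /\
      is_left_antipode L Z m (centralizer_unit Z d T0) Z2 Z0 Sl).
{ intros R mu eta T2 T0 sr TB Hsr m Z2 Z0 Hm HZ2 HZ0.
  destruct (centralizer_left_antipode_exists L Zd Hsr) as [S HS].
  exists S; split; [exact HS|]; split.
  - intros S' HS'; exact (centralizer_left_antipode_unique Zd HS HS').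
  - exact (centralizer_left_antipodeP Zd TB Hm HZ2 HZ0 Hsr HS). }
assert (He : forall (R : right_duality C) mu eta T2 T0 sl,
  is_bimonad T mu eta T2 T0 -> is_left_antipode L T mu eta T2 T0 sl ->
  forall m Z2 Z0, centralizer_mult T Z d T2 m ->
    centralizer_comult T Z d mu Z2 -> centralizer_counit T Z d eta Z0 ->
    exists Sr, centralizer_right_antipode T Z d L R sl Sr /\
      (forall Sr', centralizer_right_antipode T Z d L R sl Sr' ->
        forall X, Sr' X = Sr X) /\
      is_right_antipode R Z m (centralizer_unit Z d T0) Z2 Z0 Sr).
{ intros R mu eta T2 T0 sl TB Hsl m Z2 Z0 Hm HZ2 HZ0.
  destruct (centralizer_right_antipode_exists R Zd Hsl) as [S HS].
  exists S; split; [exact HS|]; split.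
  - intros S' HS'; exact (centralizer_right_antipode_unique Zd HS HS').
  - exact (centralizer_right_antipodeP Zd TB Hm HZ2 HZ0 Hsl HS). }
split; [|split; [|split; [|split; [exact Hd | split; [exact He|]]]]].
- intros T2 T0 TC; destruct (centralizer_mult_exists L Zd TC) as [m Hm].
  exists m; split; [exact Hm|]; split.
  + intros m' Hm'; exact (centralizer_mult_unique L Zd Hm Hm').
  + exact (centralizer_monad L Zd TC Hm).
- intros mu eta TM; destruct (centralizer_comult_exists Zd TM) as [Z2 HZ2].
  destruct (centralizer_counit_exists Zd TM) as [Z0 HZ0].
  exists Z2, Z0; split; [exact HZ2|]; split.
  { intros Z2' HZ2'; exact (centralizer_comult_unique Zd HZ2 HZ2'). }
  split; [exact HZ0|]; split.
  { intros Z0' HZ0'; exact (centralizer_counit_unique Zd HZ0 HZ0'). }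
  exact (centralizer_comonoidal Zd TM HZ2 HZ0).
- intros mu eta T2 T0 TB m Z2 Z0 Hm HZ2 HZ0.
  exact (centralizer_bimonad L Zd TB Hm HZ2 HZ0).
- intros R mu eta T2 T0 [TB [sl Hsl] [sr Hsr]] m Z2 Z0 Hm HZ2 HZ0; split.
  + exact (centralizer_bimonad L Zd TB Hm HZ2 HZ0).
  + destruct (Hd R _ _ _ _ _ TB Hsr _ _ _ Hm HZ2 HZ0) as (S & _ & _ & HS).
    exists S; exact HS.
  + destruct (He R _ _ _ _ _ TB Hsl _ _ _ Hm HZ2 HZ0) as (S & _ & _ & HS).
    exists S; exact HS.
Qed.
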